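(* Let $f$ be a conformal map of $\mathbb{D}$ onto a bounded convex domain, normalized by $f(0)=0$, $f'(0)=1$, with second Taylor coefficient $a_2=f''(0)/2$, and let $f^{*}=\dfrac{f}{1+a_2f}$. Then there exists a constant $c<1$ such that $$|a_2f^{*}(z)|\leq c<1\quad\text{for all } z\in\mathbb{D}.$$
   Context: $\mathbb{D}$ is the open unit disk in $\mathbb{C}$. For such $f$ the value $-1/a_2$ (when $a_2\ne0$) is not in $f(\mathbb{D})$, so $f^{*}$ is analytic in $\mathbb{D}$. *)

(* Defs.v *)
From Stdlib Require Import Reals.
From Coquelicot Require Import Coquelicot.

Open Scope C_scope.

Definition unit_disk (z : C) : Prop := (Cmod z < 1)%R.

Definition holomorphic_on (f : C -> C) (U : C -> Prop) : Prop :=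
  forall z : C, U z ->
    ex_derive (K := C_AbsRing) (V := C_NormedModule) f z.

(* Only the values of [f] on [U] matter when [U] is open. That [f'] has no
   zero in [U] is a consequence of injectivity, not part of the definition. *)
Definition conformal_map_onto (f : C -> C) (U V : C -> Prop) : Prop :=
  holomorphic_on f U /\
  (forall z1 z2 : C, U z1 -> U z2 -> f z1 = f z2 -> z1 = z2) /\
  (forall w : C, V w <-> exists z : C, U z /\ f z = w).

Definition bounded_set (V : C -> Prop) : Prop :=
  exists M : R, forall w : C, V w -> (Cmod w <= M)%R.

Definition convex_set (V : C -> Prop) : Prop :=
  forall (w1 w2 : C) (t : R), V w1 -> V w2 -> (0 <= t <= 1)%R ->
    V (RtoC (1 - t) * w1 + RtoC t * w2).

(* A domain is a nonempty connected open set; connectedness is implied here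
   by convexity. *)
Definition bounded_convex_domain (V : C -> Prop) : Prop :=
  (exists w : C, V w) /\ open V /\ convex_set V /\ bounded_set V.

(* [C_derive] is total; for [f] holomorphic near 0 both derivatives below
   exist, so this is the genuine value of f''(0)/2. *)
Definition a2 (f : C -> C) : C := C_derive (C_derive f) 0 / 2.

Definition fstar (f : C -> C) (z : C) : C := f z / (1 + a2 f * f z).

(* Main.v *)
Require Import Defs.
From Stdlib Require Import Reals Lra Lia ClassicalEpsilon.
From Coquelicot Require Import Coquelicot.

(** For convex [Omega] and [w] in it, [z |-> f^-1 (f z + t (w - f z))] maps the
    disk into itself.  Differentiating the Schwarz-Pick inequality between [0]
    and [z] at [t = 0] gives, for the generator [G = (w - f) / f'],
      [Re (conj z (G z - w)) + |z|^2 Re (conj w z) <= 0],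
    that is, [Re P <= 0] for [P z = (G z - w) / z + conj w z].  As
    [P 0 = - 1 - 2 a2 w], this reads [Re (a2 w) >= - 1/2] at [z = 0].  If the
    infimum of [Re (a2 w)] over the bounded set [Omega] were [- 1/2], it would be
    attained at some [w] in the closure of [Omega], and [Re P], vanishing at [0],
    would vanish identically.  Then the trajectory [s |-> f^-1 (- s w)] satisfies
    [d(1 - |z|^2)/ds >= - 2 |w| (1 - |z|^2)], so it cannot reach the unit circle
    while [- s w] runs up to the boundary of [Omega], a contradiction.  A strict
    lower bound [Re (a2 w) >= - 1/2 + delta] is the claim, because
    [|1 + x|^2 - |x|^2 = 1 + 2 Re x].

    The Cauchy theory needed for this rests on Goursat's theorem for rectangles,
    and the maximum principle on second order Taylor expansions alone. *)

Open Scope R_scope.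

(** * Complex differentiability *)

(** Boundedness is decisive: for the half-plane map z / (1 - z) one has a2 = 1, the infimum of Re
    (a2 w) over the image is exactly - 1/2, and [fstar] is the identity. So the proof must see the
    whole image, and the trajectory does this. It follows the ray opposite to w because there w - f
    z = (1 + s) w is parallel to the velocity - w of f z; hence z moves along G backwards, up to the
    factor 1 + s, and the extremal identity Re (conj z G) = Re (conj z w) (1 - |z|^2) controls its
    modulus. An extremal w may be a boundary point, whereas the self-maps of the disk are built for
    w in Omega; as G is affine in w, its inequality extends to the closure by continuity. Function
    theory enters because G is holomorphic only if f' is holomorphic and zero-free, because f^-1 has
    to be differentiated, and through Schwarz's lemma. Injectivity replaces the counting of zeros:
    zero-freeness of f' and openness of f both follow from the maximum principle applied to
    reciprocals. *)

Definition near (z : C) (P : C -> Prop) : Prop :=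
  exists d, 0 < d /\ forall x, Cmod (x - z)%C < d -> P x.

Definition ccont (f : C -> C) (z : C) : Prop :=
  forall eps, 0 < eps -> near z (fun x => Cmod (f x - f z)%C < eps).

(* Caratheodory's form of complex differentiability: the difference quotient
   extends continuously to [z]. *)
Definition cder (f : C -> C) (z l : C) : Prop :=
  exists psi, ccont psi z /\ psi z = l /\
    near z (fun x => (f x - f z = psi x * (x - z))%C).

Lemma near_and z P Q : near z P -> near z Q -> near z (fun x => P x /\ Q x).
Proof.
  intros [d [Hd HP]] [e [He HQ]]; exists (Rmin d e); split.
  - now apply Rmin_glb_lt.
  - intros x Hx; split; [apply HP | apply HQ];
      eapply Rlt_le_trans; eauto; [apply Rmin_l | apply Rmin_r].
Qed.

Lemma near_imp z (P Q : C -> Prop) : (forall x, P x -> Q x) -> near z P -> near z Q.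
Proof. intros H [d [Hd HP]]; exists d; split; auto. Qed.

Lemma Cmod_minus_self (z : C) : Cmod (z - z)%C = 0.
Proof. replace (z - z)%C with (RtoC 0) by ring; apply Cmod_0. Qed.

Lemma Cmod_minus_sym (x y : C) : Cmod (x - y)%C = Cmod (y - x)%C.
Proof. rewrite <- Cmod_opp; f_equal; ring. Qed.

Lemma Cmod_triangle_minus (x y : C) : Cmod (x - y)%C <= Cmod x + Cmod y.
Proof.
  replace (x - y)%C with (x + - y)%C by ring.
  rewrite <- (Cmod_opp y); apply Cmod_triangle.
Qed.

Lemma Cmod_triangle_rev (x y : C) : Cmod x - Cmod y <= Cmod (x - y)%C.
Proof.
  pose proof (Cmod_triangle (x - y) y) as H.
  replace (x - y + y)%C with x in H by ring; lra.
Qed.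

Lemma Cmod_triangle_via (x y z : C) : Cmod (x - z)%C <= Cmod (x - y)%C + Cmod (y - z)%C.
Proof.
  replace (x - z)%C with ((x - y) + (y - z))%C by ring; apply Cmod_triangle.
Qed.

Lemma near_self z P : near z P -> P z.
Proof. intros [d [Hd H]]; apply H; now rewrite Cmod_minus_self. Qed.

Lemma near_ball z d : 0 < d -> near z (fun x => Cmod (x - z)%C < d).
Proof. exists d; auto. Qed.

Lemma near_true z (P : C -> Prop) : (forall x, P x) -> near z P.
Proof. exists 1; split; auto; lra. Qed.

(** Disks are open. This lets an identity valid near [z] be differentiated at every point near [z],
    as second derivatives require. *)
Lemma near_trans z P : near z P -> near z (fun x => near x P).
Proof.
  intros [d [Hd H]]; exists d; split; auto; intros x Hx.
  exists (d - Cmod (x - z)%C); split; [lra|]; intros y Hy; apply H.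
  pose proof (Cmod_triangle_via y x z); lra.
Qed.

Lemma ccont_const c z : ccont (fun _ => c) z.
Proof. intros e He; apply near_true; intros; now rewrite Cmod_minus_self. Qed.

Lemma ccont_id z : ccont (fun x => x) z.
Proof. intros e He; exists e; auto. Qed.

Lemma ccont_ext_near f g z : near z (fun x => f x = g x) -> ccont f z -> ccont g z.
Proof.
  intros H Hf e He.
  pose proof (near_self _ _ H) as E; simpl in E.
  generalize (near_and _ _ _ H (Hf e He)); apply near_imp.
  intros x [E1 E2]; now rewrite <- E, <- E1.
Qed.

Lemma ccont_plus f g z : ccont f z -> ccont g z -> ccont (fun x => f x + g x)%C z.
Proof.
  intros Hf Hg e He.
  generalize (near_and _ _ _ (Hf (e/2) ltac:(lra)) (Hg (e/2) ltac:(lra))); apply near_imp.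
  intros x [H1 H2].
  replace (f x + g x - (f z + g z))%C with ((f x - f z) + (g x - g z))%C by ring.
  pose proof (Cmod_triangle (f x - f z) (g x - g z)); lra.
Qed.

Lemma ccont_opp f z : ccont f z -> ccont (fun x => - f x)%C z.
Proof.
  intros Hf e He; generalize (Hf e He); apply near_imp; intros x Hx.
  replace (- f x - - f z)%C with (- (f x - f z))%C by ring; now rewrite Cmod_opp.
Qed.

Lemma ccont_minus f g z : ccont f z -> ccont g z -> ccont (fun x => f x - g x)%C z.
Proof. intros Hf Hg; apply ccont_plus; auto; now apply ccont_opp. Qed.

Lemma ccont_mult f g z : ccont f z -> ccont g z -> ccont (fun x => f x * g x)%C z.
Proof.
  intros Hf Hg e He.
  pose proof (Cmod_ge_0 (f z)) as Pf; pose proof (Cmod_ge_0 (g z)) as Pg.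
  set (k := Cmod (f z) + Cmod (g z) + 1).
  assert (Hk : 0 < k) by (unfold k; lra).
  set (r := Rmin 1 (e / k)).
  assert (Hr : 0 < r) by (unfold r; apply Rmin_glb_lt; [lra | now apply Rdiv_lt_0_compat]).
  generalize (near_and _ _ _ (Hf r Hr) (Hg r Hr)); apply near_imp.
  intros x [H1 H2].
  replace (f x * g x - f z * g z)%C
    with ((f x - f z) * (g x - g z) + ((f x - f z) * g z + f z * (g x - g z)))%C by ring.
  eapply Rle_lt_trans; [apply Cmod_triangle|].
  eapply Rle_lt_trans; [apply Rplus_le_compat_l, Cmod_triangle|].
  rewrite !Cmod_mult.
  assert (r <= 1) by apply Rmin_l.
  assert (r * k <= e).
  { apply Rle_trans with (e / k * k); [|right; field; lra].
    apply Rmult_le_compat_r; [lra | apply Rmin_r]. }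
  pose proof (Cmod_ge_0 (f x - f z)); pose proof (Cmod_ge_0 (g x - g z)).
  unfold k in *; nra.
Qed.

Lemma ccont_inv f z : ccont f z -> f z <> 0%C -> ccont (fun x => / f x)%C z.
Proof.
  intros Hf Hz e He.
  assert (Pz : 0 < Cmod (f z)) by now apply Cmod_gt_0.
  set (m := Cmod (f z)) in *.
  assert (Hr : 0 < Rmin (m / 2) (e * (m * m) / 2)).
  { apply Rmin_glb_lt; [lra|]. apply Rdiv_lt_0_compat; [|lra].
    apply Rmult_lt_0_compat; nra. }
  generalize (Hf _ Hr); apply near_imp; intros x Hx.
  assert (H1 : Cmod (f x - f z) < m / 2) by (eapply Rlt_le_trans; [apply Hx | apply Rmin_l]).
  assert (H2 : Cmod (f x - f z) < e * (m * m) / 2) by (eapply Rlt_le_trans; [apply Hx | apply Rmin_r]).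
  assert (H3 : m / 2 < Cmod (f x)).
  { pose proof (Cmod_triangle_rev (f z) (f z - f x)) as H.
    replace (f z - (f z - f x))%C with (f x) in H by ring.
    rewrite (Cmod_minus_sym (f z)) in H; fold m in H; lra. }
  assert (Hx0 : f x <> 0%C) by (apply Cmod_gt_0; lra).
  replace (/ f x - / f z)%C with ((f z - f x) * / (f x * f z))%C by (field; auto).
  rewrite Cmod_mult, Cmod_inv, Cmod_mult, Cmod_minus_sym by (now apply Cmult_neq_0).
  fold m.
  assert (Hmm : m / 2 * m < Cmod (f x) * m) by nra.
  apply Rmult_lt_reg_r with (Cmod (f x) * m); [nra|].
  rewrite Rmult_assoc, Rinv_l by nra.
  nra.
Qed.

Lemma ccont_div f g z : ccont f z -> ccont g z -> g z <> 0%C -> ccont (fun x => f x / g x)%C z.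
Proof. intros; apply ccont_mult; auto; now apply ccont_inv. Qed.

Lemma ccont_comp f g z : ccont f z -> ccont g (f z) -> ccont (fun x => g (f x)) z.
Proof.
  intros Hf Hg e He; destruct (Hg e He) as [d [Hd H]].
  generalize (Hf d Hd); apply near_imp; auto.
Qed.

Lemma cder_ccont f z l : cder f z l -> ccont f z.
Proof.
  intros [psi [H1 [H2 H3]]].
  apply ccont_ext_near with (fun x => f z + psi x * (x - z))%C.
  - generalize H3; apply near_imp; intros x E; rewrite <- E; ring.
  - apply ccont_plus; [apply ccont_const|]; apply ccont_mult; auto.
    apply ccont_minus; [apply ccont_id | apply ccont_const].
Qed.

Lemma cder_const c z : cder (fun _ => c) z 0%C.
Proof.
  exists (fun _ => 0%C); repeat split; [apply ccont_const|].
  apply near_true; intros; ring.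
Qed.

Lemma cder_id z : cder (fun x => x) z 1%C.
Proof.
  exists (fun _ => 1%C); repeat split; [apply ccont_const|].
  apply near_true; intros; ring.
Qed.

Lemma cder_plus f g z l m : cder f z l -> cder g z m -> cder (fun x => f x + g x)%C z (l + m)%C.
Proof.
  intros [p [P1 [P2 P3]]] [q [Q1 [Q2 Q3]]].
  exists (fun x => p x + q x)%C; repeat split; [now apply ccont_plus | now rewrite P2, Q2 |].
  generalize (near_and _ _ _ P3 Q3); apply near_imp; intros x [A B].
  transitivity ((f x - f z) + (g x - g z))%C; [ring | rewrite A, B; ring].
Qed.

Lemma cder_mult f g z l m : cder f z l -> cder g z m ->
  cder (fun x => f x * g x)%C z (l * g z + f z * m)%C.
Proof.
  intros Hf Hg; pose proof (cder_ccont _ _ _ Hg) as Cg; revert Hf Hg.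
  intros [p [P1 [P2 P3]]] [q [Q1 [Q2 Q3]]].
  exists (fun x => p x * g x + f z * q x)%C; repeat split.
  - apply ccont_plus; apply ccont_mult; auto; apply ccont_const.
  - now rewrite P2, Q2.
  - generalize (near_and _ _ _ P3 Q3); apply near_imp; intros x [A B].
    transitivity ((f x - f z) * g x + f z * (g x - g z))%C; [ring | rewrite A, B; ring].
Qed.

Lemma cder_opp f z l : cder f z l -> cder (fun x => - f x)%C z (- l)%C.
Proof.
  intros [p [P1 [P2 P3]]]; exists (fun x => - p x)%C; repeat split.
  - now apply ccont_opp.
  - now rewrite P2.
  - generalize P3; apply near_imp; intros x A.
    transitivity (- (f x - f z))%C; [ring | rewrite A; ring].
Qed.

Lemma cder_minus f g z l m : cder f z l -> cder g z m -> cder (fun x => f x - g x)%C z (l - m)%C.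
Proof. intros Hf Hg; apply cder_plus; auto; now apply cder_opp. Qed.

Lemma near_neq f z c : ccont f z -> f z <> c -> near z (fun x => f x <> c).
Proof.
  intros Hf Hz.
  assert (P : 0 < Cmod (f z - c)) by (apply Cmod_gt_0; now apply Cminus_eq_contra).
  generalize (Hf _ P); apply near_imp; intros x Hx E.
  rewrite E, Cmod_minus_sym in Hx; lra.
Qed.

Lemma cder_inv f z l : cder f z l -> f z <> 0%C -> cder (fun x => / f x)%C z (- l / (f z * f z))%C.
Proof.
  intros Hf Hz; pose proof (cder_ccont _ _ _ Hf) as Cf; revert Hf.
  intros [p [P1 [P2 P3]]].
  exists (fun x => - p x / (f x * f z))%C; repeat split.
  - apply ccont_div; [now apply ccont_opp | | now apply Cmult_neq_0].
    apply ccont_mult; auto; apply ccont_const.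
  - now rewrite P2.
  - generalize (near_and _ _ _ P3 (near_neq _ _ _ Cf Hz)); apply near_imp; intros x [A B].
    transitivity (- (f x - f z) / (f x * f z))%C; [field; auto | rewrite A; field; auto].
Qed.

Lemma cder_div f g z l m : cder f z l -> cder g z m -> g z <> 0%C ->
  cder (fun x => f x / g x)%C z ((l * g z - f z * m) / (g z * g z))%C.
Proof.
  intros Hf Hg Hz.
  replace ((l * g z - f z * m) / (g z * g z))%C
    with (l * / g z + f z * (- m / (g z * g z)))%C by (field; auto).
  apply (cder_mult f (fun x => / g x)%C); auto; now apply cder_inv.
Qed.

Lemma cder_comp f g z l m : cder f z l -> cder g (f z) m -> cder (fun x => g (f x)) z (m * l)%C.
Proof.
  intros Hf Hg; pose proof (cder_ccont _ _ _ Hf) as Cf; revert Hf Hg.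
  intros [p [P1 [P2 P3]]] [q [Q1 [Q2 [d [Hd Q3]]]]].
  exists (fun x => q (f x) * p x)%C; repeat split.
  - apply ccont_mult; auto; now apply ccont_comp.
  - now rewrite P2, Q2.
  - generalize (near_and _ _ _ P3 (Cf d Hd)); apply near_imp; intros x [A B].
    rewrite (Q3 _ B), A; ring.
Qed.

Lemma cder_ext_near f g z l : near z (fun x => f x = g x) -> cder f z l -> cder g z l.
Proof.
  intros H [p [P1 [P2 P3]]]; exists p; repeat split; auto.
  pose proof (near_self _ _ H) as E; simpl in E.
  generalize (near_and _ _ _ H P3); apply near_imp; intros x [A B].
  now rewrite <- A, <- E.
Qed.

Lemma cder_approx f z l : cder f z l -> forall eps, 0 < eps ->
  near z (fun x => Cmod (f x - f z - l * (x - z))%C <= eps * Cmod (x - z)%C).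
Proof.
  intros [p [P1 [P2 P3]]] e He.
  generalize (near_and _ _ _ P3 (P1 e He)); apply near_imp; intros x [A B].
  rewrite A, <- P2.
  replace (p x * (x - z) - p z * (x - z))%C with ((p x - p z) * (x - z))%C by ring.
  rewrite Cmod_mult; apply Rmult_le_compat_r; [apply Cmod_ge_0 | lra].
Qed.

(** The way back from the little-o form, which estimates produce and [is_derive] unfolds to, to
    Caratheodory's form, in which the rules of calculus above are algebraic identities. *)
Lemma cder_of_approx f z l :
  (forall eps, 0 < eps ->
    near z (fun x => Cmod (f x - f z - l * (x - z))%C <= eps * Cmod (x - z)%C)) ->
  cder f z l.
Proof.
  intros H.
  exists (fun x => if Ceq_dec x z then l else ((f x - f z) / (x - z))%C).
  destruct (Ceq_dec z z) as [E0|]; [|easy]; repeat split.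
  - intros e He; generalize (H (e/2) ltac:(lra)); apply near_imp; intros x Hx.
    destruct (Ceq_dec z z) as [_|]; [|easy].
    destruct (Ceq_dec x z) as [_|Hn]; [now rewrite Cmod_minus_self|].
    apply Cminus_eq_contra in Hn.
    assert (P : 0 < Cmod (x - z)) by now apply Cmod_gt_0.
    replace ((f x - f z) / (x - z) - l)%C
      with ((f x - f z - l * (x - z)) / (x - z))%C by (field; auto).
    rewrite Cmod_div by auto.
    apply Rle_lt_trans with (e / 2); [|lra].
    apply Rmult_le_reg_r with (Cmod (x - z)); auto.
    unfold Rdiv at 1; rewrite Rmult_assoc, Rinv_l; lra.
  - apply near_true; intros x; destruct (Ceq_dec x z) as [->|Hn]; [ring|].
    apply Cminus_eq_contra in Hn; field; auto.
Qed.

Lemma cder_is_derive f z l :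
  cder f z l -> is_derive (K := C_AbsRing) (V := C_NormedModule) f z l.
Proof.
  intros H; split.
  - apply (@is_linear_scal_l C_AbsRing C_NormedModule).
  - intros x Hx eps.
    assert (E : z = x).
    { apply (@is_filter_lim_locally_unique C_AbsRing (AbsRing_NormedModule C_AbsRing)); auto. }
    subst x.
    destruct (cder_approx _ _ _ H eps (cond_pos eps)) as [d [Hd HH]].
    exists (mkposreal d Hd); intros y Hy.
    specialize (HH y Hy).
    change (Cmod (f y - f z - (y - z) * l) <= eps * Cmod (y - z)).
    now rewrite (Cmult_comm (y - z) l).
Qed.

Lemma is_derive_cder f z l :
  is_derive (K := C_AbsRing) (V := C_NormedModule) f z l -> cder f z l.
Proof.
  intros [_ H]; apply cder_of_approx; intros e He.
  destruct (H z (fun P HP => HP) (mkposreal e He)) as [d Hd].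
  exists d; split; [apply cond_pos|]; intros x Hx.
  specialize (Hd x Hx).
  rewrite Cmult_comm; exact Hd.
Qed.

Lemma cder_C_derive f z l : cder f z l -> C_derive f z = l.
Proof. intros H; apply is_C_derive_unique; now apply cder_is_derive. Qed.

Definition copen (U : C -> Prop) : Prop := forall z, U z -> near z U.

Definition hol (f : C -> C) (U : C -> Prop) : Prop := forall z, U z -> exists l, cder f z l.

Lemma holomorphic_on_hol f U : holomorphic_on f U -> hol f U.
Proof. intros H z Hz; destruct (H z Hz) as [l Hl]; exists l; now apply is_derive_cder. Qed.

Lemma hol_C_derive f U z : hol f U -> U z -> cder f z (C_derive f z).
Proof.
  intros H Hz; destruct (H z Hz) as [l Hl]; now rewrite (cder_C_derive _ _ _ Hl).
Qed.

Lemma hol_ccont f U z : hol f U -> U z -> ccont f z.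
Proof. intros H Hz; destruct (H z Hz) as [l Hl]; eapply cder_ccont; eauto. Qed.

(** * Bisection and compactness *)

Lemma nested_intervals (u v : nat -> R) :
  (forall n, u n <= u (S n)) -> (forall n, v (S n) <= v n) -> (forall n, u n <= v n) ->
  exists x, forall n, u n <= x <= v n.
Proof.
  intros Hu Hv Huv.
  assert (Mu : forall n k, u n <= u (n + k)%nat).
  { intros n k; induction k as [|k IH]; [rewrite Nat.add_0_r; lra|].
    rewrite Nat.add_succ_r; specialize (Hu (n + k)%nat); lra. }
  assert (Mv : forall n k, v (n + k)%nat <= v n).
  { intros n k; induction k as [|k IH]; [rewrite Nat.add_0_r; lra|].
    rewrite Nat.add_succ_r; specialize (Hv (n + k)%nat); lra. }
  assert (Muv : forall n m, u n <= v m).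
  { intros n m; apply Rle_trans with (u (n + m)%nat); [apply Mu|].
    apply Rle_trans with (v (n + m)%nat); [apply Huv|].
    rewrite Nat.add_comm; apply Mv. }
  destruct (completeness (fun t => exists n, t = u n)) as [x [Hx1 Hx2]].
  - exists (v O); intros t [n ->]; apply Muv.
  - exists (u O), O; auto.
  - exists x; intros n; split.
    + apply Hx1; now exists n.
    + apply Hx2; intros t [m ->]; apply Muv.
Qed.

Lemma half_pow_small (s eps : R) : 0 < eps -> exists n, s / 2 ^ n < eps.
Proof.
  intros He; destruct (Rle_dec s 0) as [Hs|Hs].
  - exists O; simpl; lra.
  - destruct (pow_lt_1_zero (/ 2) ltac:(rewrite Rabs_pos_eq; lra) (eps / s)) as [n Hn].
    { apply Rdiv_lt_0_compat; lra. }
    exists n; specialize (Hn n (le_n n)).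
    rewrite Rabs_pos_eq in Hn by (apply pow_le; lra).
    rewrite pow_inv in Hn; unfold Rdiv.
    apply Rmult_lt_compat_l with (r := s) in Hn; [|lra].
    replace (s * (eps / s)) with eps in Hn by (field; lra); lra.
Qed.

(** One bisection serves both compactness and Goursat's theorem: a property of rectangles that
    always passes to one of the four quarters concentrates at a point. *)
Lemma bisection_point (Bad : R -> R -> R -> R -> Prop) (a b c d : R) :
  (forall a b c d, a <= b -> c <= d -> Bad a b c d ->
     Bad a ((a+b)/2) c ((c+d)/2) \/ Bad ((a+b)/2) b c ((c+d)/2) \/
     Bad a ((a+b)/2) ((c+d)/2) d \/ Bad ((a+b)/2) b ((c+d)/2) d) ->
  a <= b -> c <= d -> Bad a b c d ->
  exists x y, forall eps, 0 < eps -> exists a' b' c' d',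
    a <= a' <= x /\ x <= b' <= b /\ c <= c' <= y /\ y <= d' <= d /\
    b' - a' < eps /\ d' - c' < eps /\ Bad a' b' c' d'.
Proof.
  intros Hsub Hab Hcd H0.
  (* Badness is carried inside the type, so that the choice of a bad quarter becomes a total
     function that can be iterated. *)
  set (Rect := {r : (R * R) * (R * R) |
    fst (fst r) <= snd (fst r) /\ fst (snd r) <= snd (snd r) /\
    Bad (fst (fst r)) (snd (fst r)) (fst (snd r)) (snd (snd r))}).
  set (A := fun r : Rect => fst (fst (proj1_sig r))).
  set (B := fun r : Rect => snd (fst (proj1_sig r))).
  set (C' := fun r : Rect => fst (snd (proj1_sig r))).
  set (D := fun r : Rect => snd (snd (proj1_sig r))).
  assert (Hstep : forall r : Rect, exists r' : Rect,
    A r <= A r' /\ B r' <= B r /\ C' r <= C' r' /\ D r' <= D r /\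
    B r' - A r' = (B r - A r) / 2 /\ D r' - C' r' = (D r - C' r) / 2).
  { intros [[[a1 b1] [c1 d1]] [P1 [P2 P3]]]; simpl in P1, P2, P3.
    unfold A, B, C', D; simpl.
    destruct (Hsub _ _ _ _ P1 P2 P3) as [H|[H|[H|H]]].
    - unshelve eexists (exist _ ((a1, (a1+b1)/2), (c1, (c1+d1)/2)) _); simpl; repeat split; auto; lra.
    - unshelve eexists (exist _ (((a1+b1)/2, b1), (c1, (c1+d1)/2)) _); simpl; repeat split; auto; lra.
    - unshelve eexists (exist _ ((a1, (a1+b1)/2), ((c1+d1)/2, d1)) _); simpl; repeat split; auto; lra.
    - unshelve eexists (exist _ (((a1+b1)/2, b1), ((c1+d1)/2, d1)) _); simpl; repeat split; auto; lra. }
  set (next := fun r => proj1_sig (constructive_indefinite_description _ (Hstep r))).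
  assert (Hnext : forall r,
    A r <= A (next r) /\ B (next r) <= B r /\ C' r <= C' (next r) /\ D (next r) <= D r /\
    B (next r) - A (next r) = (B r - A r) / 2 /\ D (next r) - C' (next r) = (D r - C' r) / 2).
  { intros r; unfold next; now destruct (constructive_indefinite_description _ (Hstep r)). }
  set (r0 := exist _ ((a, b), (c, d)) (conj Hab (conj Hcd H0)) : Rect).
  set (r := fun n => Nat.iter n next r0).
  assert (Hr : forall n, A (r n) <= A (r (S n)) /\ B (r (S n)) <= B (r n) /\
    C' (r n) <= C' (r (S n)) /\ D (r (S n)) <= D (r n)).
  { intros n; pose proof (Hnext (r n)); tauto. }
  assert (Hp : forall n, A (r n) <= B (r n) /\ C' (r n) <= D (r n)).
  { intros n; destruct (r n) as [? [? [? ?]]]; auto. }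
  destruct (nested_intervals (fun n => A (r n)) (fun n => B (r n))) as [x Hx]; try apply Hr; try apply Hp.
  destruct (nested_intervals (fun n => C' (r n)) (fun n => D (r n))) as [y Hy]; try apply Hr; try apply Hp.
  assert (Hs : forall n, B (r n) - A (r n) = (b - a) / 2 ^ n /\ D (r n) - C' (r n) = (d - c) / 2 ^ n).
  { induction n as [|n [I1 I2]].
    - unfold A, B, C', D; simpl; lra.
    - pose proof (Hnext (r n)) as [_ [_ [_ [_ [E1 E2]]]]].
      change (next (r n)) with (r (S n)) in E1, E2.
      rewrite E1, E2, I1, I2; simpl; split; field; apply pow_nonzero; lra. }
  assert (Hin : forall n, a <= A (r n) /\ B (r n) <= b /\ c <= C' (r n) /\ D (r n) <= d).
  { induction n as [|n I]; [unfold A, B, C', D; simpl; lra|].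
    pose proof (Hr n); lra. }
  exists x, y; intros eps He.
  destruct (half_pow_small ((b - a) + (d - c)) eps He) as [n Hn].
  exists (A (r n)), (B (r n)), (C' (r n)), (D (r n)).
  pose proof (Hx n); pose proof (Hy n); pose proof (Hin n); destruct (Hs n) as [E1 E2].
  assert (P : 0 < 2 ^ n) by (apply pow_lt; lra).
  assert (0 <= (b - a) / 2 ^ n) by (apply Rdiv_le_0_compat; lra).
  assert (0 <= (d - c) / 2 ^ n) by (apply Rdiv_le_0_compat; lra).
  rewrite Rdiv_plus_distr in Hn.
  repeat split; try lra.
  destruct (r n) as [? [? [? ?]]]; auto.
Qed.

Lemma Cmod_le_Re_Im (z : C) : Cmod z <= Rabs (Re z) + Rabs (Im z).
Proof.
  replace z with (RtoC (Re z) + Ci * RtoC (Im z))%C at 1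
    by (destruct z; unfold RtoC, Ci, Cplus, Cmult; simpl; f_equal; ring).
  eapply Rle_trans; [apply Cmod_triangle|].
  rewrite Cmod_mult, Cmod_Ci, !Cmod_R; lra.
Qed.

Lemma Im_le_Cmod (z : C) : Rabs (Im z) <= Cmod z.
Proof. eapply Rle_trans; [apply Rmax_r | apply (Rmax_Cmod z)]. Qed.

Lemma Cmod_rect_lt (z w : C) (a b c d eps : R) :
  a <= Re z <= b -> c <= Im z <= d -> a <= Re w <= b -> c <= Im w <= d ->
  b - a < eps -> d - c < eps -> Cmod (z - w)%C < 2 * eps.
Proof.
  intros; eapply Rle_lt_trans; [apply Cmod_le_Re_Im|].
  change (Re (z - w)%C) with (Re z - Re w); change (Im (z - w)%C) with (Im z - Im w).
  assert (Rabs (Re z - Re w) <= b - a) by (apply Rabs_le; lra).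
  assert (Rabs (Im z - Im w) <= d - c) by (apply Rabs_le; lra).
  lra.
Qed.

(** Bolzano-Weierstrass by bisection: a rectangle visited by [u] infinitely often has a quarter
    visited infinitely often. *)
Lemma bounded_cluster_point (u : nat -> C) (M : R) :
  (forall n, Cmod (u n) <= M) ->
  exists w, forall eps N, 0 < eps -> exists n, (N <= n)%nat /\ Cmod (u n - w)%C < eps.
Proof.
  intros HM.
  set (In := fun a b c d (n : nat) => a <= Re (u n) <= b /\ c <= Im (u n) <= d).
  assert (HM0 : 0 <= M) by (eapply Rle_trans; [apply Cmod_ge_0 | apply (HM O)]).
  destruct (bisection_point (fun a b c d => forall N, exists n, (N <= n)%nat /\ In a b c d n)
    (-M) M (-M) M) as [x [y Hxy]]; try lra.
  - intros a b c d _ _ H.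
    set (m := (a + b) / 2); set (k := (c + d) / 2).
    destruct (classic (forall N, exists n, (N <= n)%nat /\ In a m c k n)) as [|N1]; [auto|].
    destruct (classic (forall N, exists n, (N <= n)%nat /\ In m b c k n)) as [|N2]; [auto|].
    destruct (classic (forall N, exists n, (N <= n)%nat /\ In a m k d n)) as [|N3]; [auto|].
    destruct (classic (forall N, exists n, (N <= n)%nat /\ In m b k d n)) as [|N4]; [auto|].
    exfalso.
    apply not_all_ex_not in N1 as [n1 N1]; apply not_all_ex_not in N2 as [n2 N2].
    apply not_all_ex_not in N3 as [n3 N3]; apply not_all_ex_not in N4 as [n4 N4].
    destruct (H (n1 + n2 + n3 + n4)%nat) as [n [Hn [I1 I2]]].
    destruct (Rle_dec (Re (u n)) m), (Rle_dec (Im (u n)) k).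
    + apply N1; exists n; split; [lia | unfold In; lra].
    + apply N3; exists n; split; [lia | unfold In; lra].
    + apply N2; exists n; split; [lia | unfold In; lra].
    + apply N4; exists n; split; [lia | unfold In; lra].
  - intros N; exists N; split; [lia|]; unfold In.
    pose proof (HM N); pose proof (re_le_Cmod (u N)) as H1; pose proof (Im_le_Cmod (u N)) as H2.
    apply Rabs_le_between in H1; apply Rabs_le_between in H2; lra.
  - exists (x, y); intros eps N He.
    destruct (Hxy (eps / 2) ltac:(lra)) as (a & b & c & d & H1 & H2 & H3 & H4 & H5 & H6 & H7).
    destruct (H7 N) as [n [Hn [I1 I2]]]; exists n; split; auto.
    replace eps with (2 * (eps / 2)) by lra.
    apply Cmod_rect_lt with a b c d; simpl; auto; lra.
Qed.

Definition cclosed (K : C -> Prop) : Prop :=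
  forall w, (forall eps, 0 < eps -> exists z, K z /\ Cmod (z - w)%C < eps) -> K w.

Definition rcont (v : C -> R) (z : C) : Prop :=
  forall eps, 0 < eps -> near z (fun x => Rabs (v x - v z) < eps).

Lemma Rinv_INR_small (eps : R) : 0 < eps -> exists N, forall n, (N <= n)%nat -> / (INR n + 1) < eps.
Proof.
  intros He; destruct (archimed_cor1 eps He) as [N [H1 H2]]; exists N; intros n Hn.
  eapply Rle_lt_trans; [|exact H1].
  apply Rinv_le_contravar; [now apply lt_0_INR|].
  apply le_INR in Hn; lra.
Qed.

(** Two cluster point arguments: points with values tending to infinity would contradict continuity
    at their cluster point, and a maximizing sequence clusters at a maximum. *)
Lemma continuous_attains_max (v : C -> R) (K : C -> Prop) (M : R) :
  cclosed K -> (forall z, K z -> Cmod z <= M) -> (exists z, K z) ->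
  (forall z, K z -> rcont v z) ->
  exists z, K z /\ forall x, K x -> v x <= v z.
Proof.
  intros Hcl HM [z0 Hz0] Hv.
  assert (Hbd : exists B, forall z, K z -> v z <= B).
  { apply NNPP; intros N.
    assert (H : forall n : nat, exists z, K z /\ INR n < v z).
    { intros n; apply NNPP; intros N'; apply N; exists (INR n); intros z Hz.
      apply Rnot_lt_le; intros L; apply N'; eauto. }
    destruct (bounded_cluster_point (fun n => proj1_sig (constructive_indefinite_description _ (H n))) M) as [w Hw].
    { intros n; destruct (constructive_indefinite_description _ (H n)) as [z [Kz ?]]; simpl; auto. }
    assert (Kw : K w).
    { apply Hcl; intros e He; destruct (Hw e O He) as [n [_ Hn]].
      destruct (constructive_indefinite_description _ (H n)) as [z [Kz ?]]; simpl in Hn; eauto. }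
    destruct (Hv w Kw 1 ltac:(lra)) as [d [Hd HH]].
    destruct (INR_unbounded (v w + 1)) as [N0 HN0].
    destruct (Hw d N0 Hd) as [n [Hn Hn2]].
    destruct (constructive_indefinite_description _ (H n)) as [z [Kz Hz]]; simpl in Hn2.
    apply HH in Hn2; apply Rabs_def2 in Hn2; apply le_INR in Hn; lra. }
  destruct (completeness (fun t => exists z, K z /\ t = v z)) as [s [Hs1 Hs2]].
  { destruct Hbd as [B HB]; exists B; intros t [z [Hz ->]]; auto. }
  { exists (v z0), z0; auto. }
  assert (H : forall n : nat, exists z, K z /\ s - / (INR n + 1) < v z).
  { intros n; apply NNPP; intros N.
    assert (P : 0 < / (INR n + 1)) by (apply Rinv_0_lt_compat; pose proof (pos_INR n); lra).
    assert (s <= s - / (INR n + 1)); [|lra].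
    apply Hs2; intros t [z [Hz ->]]; apply Rnot_lt_le; intros L; apply N; eauto. }
  destruct (bounded_cluster_point (fun n => proj1_sig (constructive_indefinite_description _ (H n))) M) as [w Hw].
  { intros n; destruct (constructive_indefinite_description _ (H n)) as [z [Kz ?]]; simpl; auto. }
  assert (Kw : K w).
  { apply Hcl; intros e He; destruct (Hw e O He) as [n [_ Hn]].
    destruct (constructive_indefinite_description _ (H n)) as [z [Kz ?]]; simpl in Hn; eauto. }
  exists w; split; auto.
  intros x Hx; apply Rle_trans with s; [apply Hs1; eauto|].
  apply Rnot_lt_le; intros L.
  destruct (Hv w Kw ((s - v w) / 2) ltac:(lra)) as [d [Hd HH]].
  destruct (Rinv_INR_small ((s - v w) / 2) ltac:(lra)) as [N0 HN0].
  destruct (Hw d N0 Hd) as [n [Hn Hn2]].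
  specialize (HN0 n Hn).
  destruct (constructive_indefinite_description _ (H n)) as [z [Kz Hz]]; simpl in Hn2.
  apply HH in Hn2; apply Rabs_def2 in Hn2; lra.
Qed.

(** * Integration along the boundary of a rectangle *)

Definition CRInt (g : R -> C) (a b : R) : C :=
  @RInt C_R_CompleteNormedModule g a b.

Definition ex_CRInt (g : R -> C) (a b : R) : Prop :=
  @ex_RInt C_R_NormedModule g a b.

Lemma norm_C_R (z : C) : @norm R_AbsRing C_R_NormedModule z = Cmod z.
Proof.
  unfold Cmod, norm; simpl; unfold prod_norm, norm; simpl; unfold abs; simpl.
  f_equal; rewrite !Rmult_1_r, <- !Rabs_mult, !Rabs_pos_eq; auto; nra.
Qed.

(** Here [C] is a module over the reals, so a complex scalar is treated through real and imaginary
    parts. *)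
Lemma is_CRInt_mult (g : R -> C) a b (k l : C) :
  @is_RInt C_R_NormedModule g a b l ->
  @is_RInt C_R_NormedModule (fun t => k * g t)%C a b (k * l)%C.
Proof.
  intros H.
  pose proof (is_RInt_fct_extend_fst (U := R_NormedModule) (V := R_NormedModule) _ _ _ _ H) as H1.
  pose proof (is_RInt_fct_extend_snd (U := R_NormedModule) (V := R_NormedModule) _ _ _ _ H) as H2.
  apply (is_RInt_fct_extend_pair (U := R_NormedModule) (V := R_NormedModule)
    (fun t => k * g t)%C a b (fst k * fst l - snd k * snd l)%R (fst k * snd l + snd k * fst l)%R).
  - apply (is_RInt_minus (V := R_NormedModule) (fun t => fst k * fst (g t)) (fun t => snd k * snd (g t))).
    + now apply (is_RInt_scal (V := R_NormedModule) (fun t => fst (g t))).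
    + now apply (is_RInt_scal (V := R_NormedModule) (fun t => snd (g t))).
  - apply (is_RInt_plus (V := R_NormedModule) (fun t => fst k * snd (g t)) (fun t => snd k * fst (g t))).
    + now apply (is_RInt_scal (V := R_NormedModule) (fun t => snd (g t))).
    + now apply (is_RInt_scal (V := R_NormedModule) (fun t => fst (g t))).
Qed.

Lemma CRInt_mult (g : R -> C) a b (k : C) : ex_CRInt g a b ->
  CRInt (fun t => k * g t)%C a b = (k * CRInt g a b)%C.
Proof.
  intros H; apply (@is_RInt_unique C_R_CompleteNormedModule), is_CRInt_mult.
  now apply (@RInt_correct C_R_CompleteNormedModule).
Qed.

Lemma CRInt_plus (f g : R -> C) a b : ex_CRInt f a b -> ex_CRInt g a b ->
  CRInt (fun t => f t + g t)%C a b = (CRInt f a b + CRInt g a b)%C.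
Proof. apply (@RInt_plus C_R_CompleteNormedModule). Qed.

Lemma CRInt_Chasles (g : R -> C) a b c : ex_CRInt g a b -> ex_CRInt g b c ->
  CRInt g a c = (CRInt g a b + CRInt g b c)%C.
Proof. intros; symmetry; now apply (@RInt_Chasles C_R_CompleteNormedModule). Qed.

Lemma CRInt_bound (g : R -> C) a b M : a <= b -> ex_CRInt g a b ->
  (forall t, a <= t <= b -> Cmod (g t) <= M) -> Cmod (CRInt g a b) <= (b - a) * M.
Proof.
  intros Hab H HM; rewrite <- norm_C_R.
  apply (norm_RInt_le_const (V := C_R_NormedModule) g); auto.
  - intros; rewrite norm_C_R; auto.
  - now apply (@RInt_correct C_R_CompleteNormedModule).
Qed.

Lemma ccont_line (h : C -> C) (g : R -> C) (t : R) (k : R) : 0 < k ->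
  (forall s, Cmod (g s - g t)%C <= k * Rabs (s - t)) -> ccont h (g t) ->
  @continuous R_UniformSpace C_UniformSpace (fun s => h (g s)) t.
Proof.
  intros Hk Hg Hh P [e HP].
  destruct (Hh e (cond_pos e)) as [d [Hd HH]].
  assert (Hdk : 0 < d / k) by now apply Rdiv_lt_0_compat.
  exists (mkposreal _ Hdk); intros s Hs; apply HP.
  assert (L : Cmod (g s - g t) < d).
  { eapply Rle_lt_trans; [apply Hg|].
    change (Rabs (s - t) < d / k) in Hs.
    apply Rmult_lt_compat_l with (r := k) in Hs; auto.
    replace (k * (d / k)) with d in Hs by (field; lra); lra. }
  (* The uniform structure of [C] is that of a product: a ball is a square, and each coordinate has
     to be bounded. *)
  apply HH in L; pose proof (Rmax_Cmod (h (g s) - h (g t))%C) as Hm.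
  split.
  - eapply Rle_lt_trans; [|exact L]; eapply Rle_trans; [apply Rmax_l | exact Hm].
  - eapply Rle_lt_trans; [|exact L]; eapply Rle_trans; [apply Rmax_r | exact Hm].
Qed.

Lemma Cmod_horizontal (s t y : R) : Cmod ((s, y) - (t, y))%C = Rabs (s - t).
Proof.
  replace ((s, y) - (t, y))%C with (RtoC (s - t))
    by (unfold RtoC, Cminus, Cplus, Copp; simpl; f_equal; ring).
  apply Cmod_R.
Qed.

Lemma Cmod_vertical (s t x : R) : Cmod ((x, s) - (x, t))%C = Rabs (s - t).
Proof.
  replace ((x, s) - (x, t))%C with (Ci * RtoC (s - t))%C
    by (unfold RtoC, Ci, Cmult, Cminus, Cplus, Copp; simpl; f_equal; ring).
  rewrite Cmod_mult, Cmod_Ci, Cmod_R; ring.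
Qed.

Lemma ex_CRInt_h (h : C -> C) a b y : a <= b -> (forall x, a <= x <= b -> ccont h (x, y)) ->
  ex_CRInt (fun x => h (x, y)) a b.
Proof.
  intros Hab H; apply (@ex_RInt_continuous C_R_CompleteNormedModule).
  rewrite Rmin_left, Rmax_right by lra; intros x Hx.
  apply (ccont_line h (fun x => (x, y)) x 1); auto; try lra.
  intros s; rewrite Cmod_horizontal; lra.
Qed.

Lemma ex_CRInt_v (h : C -> C) c d x : c <= d -> (forall y, c <= y <= d -> ccont h (x, y)) ->
  ex_CRInt (fun y => h (x, y)) c d.
Proof.
  intros Hab H; apply (@ex_RInt_continuous C_R_CompleteNormedModule).
  rewrite Rmin_left, Rmax_right by lra; intros y Hy.
  apply (ccont_line h (fun y => (x, y)) y 1); auto; try lra.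
  intros s; rewrite Cmod_vertical; lra.
Qed.

Lemma is_derive_line (H : C -> C) (g : R -> C) (t : R) (l v : C) :
  (forall s, g s - g t = (s - t)%R * v)%C -> Cmod v = 1 -> cder H (g t) l ->
  is_derive (K := R_AbsRing) (V := C_R_NormedModule) (fun s => H (g s)) t (l * v)%C.
Proof.
  intros Hg Hv HH.
  assert (Hm : forall s, Cmod (g s - g t) = Rabs (s - t)).
  { intros s; rewrite Hg, Cmod_mult, Cmod_R, Hv; ring. }
  split; [apply (@is_linear_scal_l R_AbsRing C_R_NormedModule)|].
  intros x Hx eps.
  assert (E : t = x).
  { apply (@is_filter_lim_locally_unique R_AbsRing R_NormedModule); auto. }
  subst x.
  destruct (cder_approx _ _ _ HH eps (cond_pos eps)) as [d [Hd HA]].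
  exists (mkposreal d Hd); intros s Hs.
  change (Rabs (s - t) < d) in Hs.
  rewrite <- Hm in Hs; apply HA in Hs.
  rewrite norm_C_R.
  change (Cmod (minus (minus (H (g s)) (H (g t))) (@scal _ C_R_NormedModule (s - t)%R (l * v)%C))
    <= eps * Rabs (s - t)).
  rewrite <- Hm, scal_R_Cmult.
  replace (minus (minus (H (g s)) (H (g t))) ((s - t)%R * (l * v)))%C
    with (H (g s) - H (g t) - l * (g s - g t))%C by (rewrite Hg; unfold minus, plus, opp; simpl; ring).
  exact Hs.
Qed.

(* The boundary of [[a,b] x [c,d]] is run anticlockwise. *)
Definition rint (h : C -> C) (a b c d : R) : C :=
  (CRInt (fun x => h (x, c)) a b - CRInt (fun x => h (x, d)) a b +
   Ci * (CRInt (fun y => h (b, y)) c d - CRInt (fun y => h (a, y)) c d))%C.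

Definition in_rect (a b c d : R) (z : C) : Prop := a <= Re z <= b /\ c <= Im z <= d.

Definition on_edge (a b c d : R) (z : C) : Prop :=
  in_rect a b c d z /\ (Re z = a \/ Re z = b \/ Im z = c \/ Im z = d).

Definition edge_cont (h : C -> C) (a b c d : R) : Prop :=
  forall z, on_edge a b c d z -> ccont h z.

Lemma edge_cont_ex (h : C -> C) a b c d : a <= b -> c <= d -> edge_cont h a b c d ->
  ex_CRInt (fun x => h (x, c)) a b /\ ex_CRInt (fun x => h (x, d)) a b /\
  ex_CRInt (fun y => h (b, y)) c d /\ ex_CRInt (fun y => h (a, y)) c d.
Proof.
  intros Hab Hcd H; repeat split.
  - apply ex_CRInt_h; auto; intros; apply H; unfold on_edge, in_rect; simpl; lra.
  - apply ex_CRInt_h; auto; intros; apply H; unfold on_edge, in_rect; simpl; lra.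
  - apply ex_CRInt_v; auto; intros; apply H; unfold on_edge, in_rect; simpl; lra.
  - apply ex_CRInt_v; auto; intros; apply H; unfold on_edge, in_rect; simpl; lra.
Qed.

Lemma rint_plus (f g : C -> C) a b c d : a <= b -> c <= d ->
  edge_cont f a b c d -> edge_cont g a b c d ->
  rint (fun z => f z + g z)%C a b c d = (rint f a b c d + rint g a b c d)%C.
Proof.
  intros Hab Hcd Hf Hg.
  destruct (edge_cont_ex _ _ _ _ _ Hab Hcd Hf) as (F1 & F2 & F3 & F4).
  destruct (edge_cont_ex _ _ _ _ _ Hab Hcd Hg) as (G1 & G2 & G3 & G4).
  unfold rint.
  rewrite (CRInt_plus (fun x => f (x, c)) (fun x => g (x, c))),
    (CRInt_plus (fun x => f (x, d)) (fun x => g (x, d))),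
    (CRInt_plus (fun y => f (b, y)) (fun y => g (b, y))),
    (CRInt_plus (fun y => f (a, y)) (fun y => g (a, y))) by auto.
  ring.
Qed.

Lemma rint_mult (k : C) (f : C -> C) a b c d : a <= b -> c <= d ->
  edge_cont f a b c d -> rint (fun z => k * f z)%C a b c d = (k * rint f a b c d)%C.
Proof.
  intros Hab Hcd Hf.
  destruct (edge_cont_ex _ _ _ _ _ Hab Hcd Hf) as (F1 & F2 & F3 & F4).
  unfold rint.
  rewrite (CRInt_mult (fun x => f (x, c))), (CRInt_mult (fun x => f (x, d))),
    (CRInt_mult (fun y => f (b, y))), (CRInt_mult (fun y => f (a, y))) by auto.
  ring.
Qed.

Lemma rint_bound (h : C -> C) a b c d M : a <= b -> c <= d -> edge_cont h a b c d ->
  (forall z, on_edge a b c d z -> Cmod (h z) <= M) ->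
  Cmod (rint h a b c d) <= 2 * ((b - a) + (d - c)) * M.
Proof.
  intros Hab Hcd Hh HM.
  destruct (edge_cont_ex _ _ _ _ _ Hab Hcd Hh) as (F1 & F2 & F3 & F4).
  assert (B1 := CRInt_bound _ _ _ M Hab F1 ltac:(intros; apply HM; unfold on_edge, in_rect; simpl; lra)).
  assert (B2 := CRInt_bound _ _ _ M Hab F2 ltac:(intros; apply HM; unfold on_edge, in_rect; simpl; lra)).
  assert (B3 := CRInt_bound _ _ _ M Hcd F3 ltac:(intros; apply HM; unfold on_edge, in_rect; simpl; lra)).
  assert (B4 := CRInt_bound _ _ _ M Hcd F4 ltac:(intros; apply HM; unfold on_edge, in_rect; simpl; lra)).
  unfold rint.
  eapply Rle_trans; [apply Cmod_triangle|]; rewrite Cmod_mult, Cmod_Ci.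
  pose proof (Cmod_triangle_minus (CRInt (fun x => h (x, c)) a b) (CRInt (fun x => h (x, d)) a b)).
  pose proof (Cmod_triangle_minus (CRInt (fun y => h (b, y)) c d) (CRInt (fun y => h (a, y)) c d)).
  lra.
Qed.

Lemma rint_ext (f g : C -> C) a b c d : a <= b -> c <= d ->
  (forall z, on_edge a b c d z -> f z = g z) -> rint f a b c d = rint g a b c d.
Proof.
  intros Hab Hcd H; unfold rint, CRInt.
  f_equal; [f_equal | f_equal; f_equal]; apply RInt_ext;
    rewrite Rmin_left, Rmax_right by lra; intros t Ht; apply H;
    unfold on_edge, in_rect; simpl; lra.
Qed.

Lemma rint_split_v (h : C -> C) a m b c d : a <= m <= b -> c <= d ->
  (forall x, a <= x <= b -> ccont h (x, c) /\ ccont h (x, d)) ->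
  rint h a b c d = (rint h a m c d + rint h m b c d)%C.
Proof.
  intros Hm Hcd H; unfold rint.
  rewrite (CRInt_Chasles (fun x => h (x, c)) a m b), (CRInt_Chasles (fun x => h (x, d)) a m b)
    by (apply ex_CRInt_h; [lra|]; intros; apply H; lra).
  ring.
Qed.

Lemma rint_split_h (h : C -> C) a b c n d : a <= b -> c <= n <= d ->
  (forall y, c <= y <= d -> ccont h (a, y) /\ ccont h (b, y)) ->
  rint h a b c d = (rint h a b c n + rint h a b n d)%C.
Proof.
  intros Hab Hn H; unfold rint.
  rewrite (CRInt_Chasles (fun y => h (b, y)) c n d), (CRInt_Chasles (fun y => h (a, y)) c n d)
    by (apply ex_CRInt_v; [lra|]; intros; apply H; lra).
  ring.
Qed.

(** Each edge contributes the difference of [H] at its two ends, the factor [Ci] being the direction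
    of the vertical edges; around the rectangle these differences cancel. *)
Lemma rint_primitive (H h : C -> C) a b c d : a <= b -> c <= d -> edge_cont h a b c d ->
  (forall z, on_edge a b c d z -> cder H z (h z)) -> rint h a b c d = 0%C.
Proof.
  intros Hab Hcd Hh HH.
  destruct (edge_cont_ex _ _ _ _ _ Hab Hcd Hh) as (F1 & F2 & F3 & F4).
  assert (HX : forall y, y = c \/ y = d -> CRInt (fun x => h (x, y)) a b = (H (b, y) - H (a, y))%C).
  { intros y Hy; apply (@is_RInt_unique C_R_CompleteNormedModule).
    apply (@is_RInt_derive C_R_CompleteNormedModule (fun x => H (x, y)));
      rewrite Rmin_left, Rmax_right by lra; intros x Hx.
    - replace (h (x, y)) with (h (x, y) * 1)%C by ring.
      apply (is_derive_line H (fun x => (x, y))).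
      + intros s; unfold RtoC, Cmult, Cminus, Cplus, Copp; simpl; f_equal; ring.
      + apply Cmod_1.
      + apply HH; unfold on_edge, in_rect; simpl; lra.
    - apply (ccont_line h (fun x => (x, y)) x 1); try lra.
      + intros s; rewrite Cmod_horizontal; lra.
      + apply Hh; unfold on_edge, in_rect; simpl; lra. }
  assert (HY : forall x, x = a \/ x = b -> (Ci * CRInt (fun y => h (x, y)) c d)%C = (H (x, d) - H (x, c))%C).
  { intros x Hx; rewrite <- CRInt_mult by (destruct Hx; subst; auto).
    apply (@is_RInt_unique C_R_CompleteNormedModule).
    apply (@is_RInt_derive C_R_CompleteNormedModule (fun y => H (x, y)));
      rewrite Rmin_left, Rmax_right by lra; intros y Hy.
    - replace (Ci * h (x, y))%C with (h (x, y) * Ci)%C by ring.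
      apply (is_derive_line H (fun y => (x, y))).
      + intros s; unfold RtoC, Ci, Cmult, Cminus, Cplus, Copp; simpl; f_equal; ring.
      + apply Cmod_Ci.
      + apply HH; unfold on_edge, in_rect; simpl; lra.
    - apply (ccont_line (fun z => Ci * h z)%C (fun y => (x, y)) y 1); try lra.
      + intros s; rewrite Cmod_vertical; lra.
      + apply ccont_mult; [apply ccont_const|].
        apply Hh; unfold on_edge, in_rect; simpl; lra. }
  unfold rint.
  rewrite (HX c), (HX d) by auto.
  replace (Ci * (CRInt (fun y => h (b, y)) c d - CRInt (fun y => h (a, y)) c d))%C
    with (Ci * CRInt (fun y => h (b, y)) c d - Ci * CRInt (fun y => h (a, y)) c d)%C by ring.
  rewrite (HY b), (HY a) by auto; ring.
Qed.

(** * Goursat's theorem *)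

Lemma rint_quarters (h : C -> C) a b c d : a <= b -> c <= d ->
  (forall z, in_rect a b c d z -> ccont h z) ->
  rint h a b c d =
    (rint h a ((a+b)/2) c ((c+d)/2) + rint h ((a+b)/2) b c ((c+d)/2) +
     (rint h a ((a+b)/2) ((c+d)/2) d + rint h ((a+b)/2) b ((c+d)/2) d))%C.
Proof.
  intros Hab Hcd H.
  rewrite (rint_split_h h a b c ((c+d)/2) d) by
    (try lra; intros; split; apply H; unfold in_rect; simpl; lra).
  rewrite (rint_split_v h a ((a+b)/2) b c), (rint_split_v h a ((a+b)/2) b ((c+d)/2)) by
    (try lra; intros; split; apply H; unfold in_rect; simpl; lra).
  reflexivity.
Qed.

Lemma rint_affine (u v : C) a b c d : a <= b -> c <= d ->
  rint (fun z => u + v * z)%C a b c d = 0%C.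
Proof.
  intros Hab Hcd.
  apply rint_primitive with (H := fun z => (u * z + (v / 2) * (z * z))%C); auto.
  - intros z _; apply ccont_plus; [apply ccont_const|].
    apply ccont_mult; [apply ccont_const | apply ccont_id].
  - intros z _.
    replace (u + v * z)%C with ((0 * z + u * 1) + (0 * (z * z) + (v / 2) * (1 * z + z * 1)))%C by field.
    apply (cder_plus (fun z => u * z)%C (fun z => (v / 2) * (z * z))%C).
    + apply (cder_mult (fun _ => u) (fun z => z)); [apply cder_const | apply cder_id].
    + apply (cder_mult (fun _ => v / 2)%C (fun z => z * z)%C); [apply cder_const|].
      apply (cder_mult (fun z => z) (fun z => z)); apply cder_id.
Qed.

(** The affine part integrates to zero, so only the error of the linear approximation counts. This
    is how differentiability enters Goursat's theorem. *)
Lemma rint_affine_close (h : C -> C) (u v : C) a b c d M : a <= b -> c <= d ->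
  edge_cont h a b c d ->
  (forall z, on_edge a b c d z -> Cmod (h z - (u + v * z))%C <= M) ->
  Cmod (rint h a b c d) <= 2 * ((b - a) + (d - c)) * M.
Proof.
  intros Hab Hcd Hh HM.
  assert (Haff : forall z, ccont (fun z => u + v * z)%C z).
  { intros z; apply ccont_plus; [apply ccont_const|].
    apply ccont_mult; [apply ccont_const | apply ccont_id]. }
  assert (E1 : edge_cont (fun z => h z - (u + v * z))%C a b c d)
    by (intros z Hz; apply ccont_minus; auto).
  rewrite (rint_ext h (fun z => (h z - (u + v * z)) + (u + v * z))%C) by (auto; intros; ring).
  rewrite (rint_plus (fun z => h z - (u + v * z))%C (fun z => u + v * z)%C) by (auto; intros z Hz; auto).
  rewrite rint_affine, Cplus_0_r by auto.
  now apply rint_bound.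
Qed.

Lemma goursat (h : C -> C) a b c d : a <= b -> c <= d ->
  hol h (in_rect a b c d) -> rint h a b c d = 0%C.
Proof.
  intros Hab Hcd Hh.
  apply NNPP; intros HI; apply Cmod_gt_0 in HI.
  set (I0 := Cmod (rint h a b c d)) in *.
  set (s0 := (b - a) + (d - c)).
  (* The added 1 makes the inequality in [Bad] strict for the whole rectangle and allows
     [s0 = 0]. *)
  set (eps := I0 / (s0 * s0 + 1)).
  assert (Hs0 : 0 <= s0 * s0) by nra.
  assert (He : 0 < eps) by (apply Rdiv_lt_0_compat; lra).
  (* The squared half-perimeter of a quarter is a quarter of the original one, while the four
     integrals add up to the original integral; hence some quarter is bad again. *)
  set (Bad := fun a' b' c' d' => (a <= a' /\ b' <= b /\ c <= c' /\ d' <= d) /\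
    eps * (((b' - a') + (d' - c')) * ((b' - a') + (d' - c'))) < Cmod (rint h a' b' c' d')).
  destruct (bisection_point Bad a b c d) as [x [y Hxy]]; auto.
  - intros a' b' c' d' Hab' Hcd' [Hin HB].
    set (m := (a' + b') / 2); set (n := (c' + d') / 2).
    assert (Hm : 2 * m = a' + b') by (unfold m; lra).
    assert (Hn : 2 * n = c' + d') by (unfold n; lra).
    assert (E : rint h a' b' c' d' = (rint h a' m c' n + rint h m b' c' n +
      (rint h a' m n d' + rint h m b' n d'))%C).
    { apply rint_quarters; auto; intros z Hz.
      apply (hol_ccont h (in_rect a b c d)); auto; unfold in_rect in *; lra. }
    rewrite E in HB.
    pose proof (Cmod_triangle (rint h a' m c' n + rint h m b' c' n) (rint h a' m n d' + rint h m b' n d')).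
    pose proof (Cmod_triangle (rint h a' m c' n) (rint h m b' c' n)).
    pose proof (Cmod_triangle (rint h a' m n d') (rint h m b' n d')).
    set (q := eps * (((b' - a') + (d' - c')) * ((b' - a') + (d' - c')))) in *.
    assert (Q : forall u v, u = (b' - a') / 2 -> v = (d' - c') / 2 -> eps * ((u + v) * (u + v)) = q / 4).
    { intros u v -> ->; unfold q; field. }
    unfold Bad.
    rewrite !Q by lra.
    destruct (Rlt_dec (q / 4) (Cmod (rint h a' m c' n))); [left; lra|right].
    destruct (Rlt_dec (q / 4) (Cmod (rint h m b' c' n))); [left; lra|right].
    destruct (Rlt_dec (q / 4) (Cmod (rint h a' m n d'))); [left; lra|right].
    lra.
  - split; [lra|]; fold s0 I0; unfold eps.
    apply Rmult_lt_reg_r with (s0 * s0 + 1); [lra|].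
    replace (I0 / (s0 * s0 + 1) * (s0 * s0) * (s0 * s0 + 1)) with (I0 * (s0 * s0)) by (field; lra).
    nra.
  - set (p := (x, y) : C).
    assert (Hp : in_rect a b c d p).
    { destruct (Hxy 1 ltac:(lra)) as (a' & b' & c' & d' & H); unfold in_rect, p; simpl; lra. }
    destruct (Hh p Hp) as [l Hl].
    (* With half-perimeter s, points of the small rectangle lie within s of [p] and its perimeter is
       2 s, so the integral is at most 2 s (eps / 2) s = eps s^2, the bound that badness denies. *)
    destruct (cder_approx _ _ _ Hl (eps / 2) ltac:(lra)) as [r [Hr HA]].
    destruct (Hxy (r / 2) ltac:(lra)) as (a' & b' & c' & d' & H1 & H2 & H3 & H4 & H5 & H6 & [_ HB]).
    apply Rlt_not_le in HB; apply HB.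
    set (s := (b' - a') + (d' - c')).
    replace (eps * (s * s)) with (2 * s * (eps / 2 * s)) by field.
    apply rint_affine_close with (h p - l * p)%C l; try lra.
    + intros z [Hz _]; apply (hol_ccont h (in_rect a b c d)); auto; unfold in_rect in *; lra.
    + intros z [[Hz1 Hz2] _].
      replace (h z - (h p - l * p + l * z))%C with (h z - h p - l * (z - p))%C by ring.
      eapply Rle_trans; [apply HA|].
      * replace r with (2 * (r / 2)) by field.
        apply Cmod_rect_lt with a' b' c' d'; unfold p; simpl; auto; lra.
      * apply Rmult_le_compat_l; [lra|].
        eapply Rle_trans; [apply Cmod_le_Re_Im|].
        change (Re (z - p)%C) with (Re z - x); change (Im (z - p)%C) with (Im z - y).
        apply Rplus_le_compat; apply Rabs_le; lra.
Qed.

Lemma Rle_0_of_small (x k r0 : R) : 0 < r0 -> (forall r, 0 < r < r0 -> x <= k * r) -> x <= 0.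
Proof.
  intros Hr0 H; apply Rnot_lt_le; intros Hx.
  assert (Hk : 0 < k) by (specialize (H (r0 / 2) ltac:(lra)); nra).
  set (r := Rmin (r0 / 2) (x / k / 2)).
  assert (0 < x / k) by now apply Rdiv_lt_0_compat.
  assert (0 < r) by (apply Rmin_glb_lt; lra).
  assert (r <= r0 / 2) by apply Rmin_l.
  assert (r <= x / k / 2) by apply Rmin_r.
  specialize (H r ltac:(lra)).
  assert (k * r <= k * (x / k / 2)) by (apply Rmult_le_compat_l; lra).
  replace (k * (x / k / 2)) with (x / 2) in * by (field; lra).
  lra.
Qed.

(** A square of half-side r around [p] is cut out. The four remaining rectangles fall under
    [goursat]; on the square [h] is bounded by [M], so its boundary of length 8 r contributes at
    most 8 M r, which tends to 0. *)
Lemma goursat_except (h : C -> C) a b c d p :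
  a < Re p < b -> c < Im p < d -> ccont h p ->
  (forall z, in_rect a b c d z -> z <> p -> exists l, cder h z l) ->
  rint h a b c d = 0%C.
Proof.
  intros Hx Hy Hp Hh.
  assert (Hc : forall z, in_rect a b c d z -> ccont h z).
  { intros z Hz; destruct (Ceq_dec z p) as [->|N]; auto.
    destruct (Hh z Hz N) as [l Hl]; eapply cder_ccont; eauto. }
  destruct (Hp 1 ltac:(lra)) as [d0 [Hd0 HM]].
  set (M := Cmod (h p) + 1).
  apply Cmod_eq_0, Rle_antisym; [|apply Cmod_ge_0].
  set (r0 := Rmin (d0 / 2) (Rmin (Rmin (Re p - a) (b - Re p)) (Rmin (Im p - c) (d - Im p)))).
  assert (Hr0 : 0 < r0) by (unfold r0; repeat apply Rmin_glb_lt; lra).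
  apply (Rle_0_of_small _ (8 * M) r0 Hr0); intros r [Hr1 Hr2].
  assert (r < d0 / 2 /\ r < Re p - a /\ r < b - Re p /\ r < Im p - c /\ r < d - Im p) as (R1 & R2 & R3 & R4 & R5).
  { assert (G : forall u v, r < Rmin u v -> r < u /\ r < v).
    { intros u v; pose proof (Rmin_l u v); pose proof (Rmin_r u v); lra. }
    apply G in Hr2 as [G1 G2]; apply G in G2 as [G2 G3]; apply G in G2; apply G in G3; tauto. }
  set (x1 := Re p - r); set (x2 := Re p + r); set (y1 := Im p - r); set (y2 := Im p + r).
  assert (Hx12 : a < x1 /\ x1 < Re p < x2 /\ x2 < b) by (unfold x1, x2; lra).
  assert (Hy12 : c < y1 /\ y1 < Im p < y2 /\ y2 < d) by (unfold y1, y2; lra).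
  assert (Hol : forall a' b' c' d', a <= a' <= b' -> b' <= b -> c <= c' <= d' -> d' <= d ->
    b' < Re p \/ Re p < a' \/ d' < Im p \/ Im p < c' -> rint h a' b' c' d' = 0%C).
  { intros a' b' c' d' K1 K2 K3 K4 K; apply goursat; try lra; intros z [Z1 Z2]; apply Hh.
    - unfold in_rect; lra.
    - intros ->; lra. }
  rewrite (rint_split_v h a x1 b c d) by (try lra; intros; split; apply Hc; unfold in_rect; simpl; lra).
  rewrite (rint_split_v h x1 x2 b c d) by (try lra; intros; split; apply Hc; unfold in_rect; simpl; lra).
  rewrite (rint_split_h h x1 x2 c y1 d) by (try lra; intros; split; apply Hc; unfold in_rect; simpl; lra).
  rewrite (rint_split_h h x1 x2 y1 y2 d) by (try lra; intros; split; apply Hc; unfold in_rect; simpl; lra).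
  rewrite (Hol a x1 c d), (Hol x2 b c d), (Hol x1 x2 c y1), (Hol x1 x2 y2 d) by lra.
  replace (0 + (0 + (rint h x1 x2 y1 y2 + 0) + 0))%C with (rint h x1 x2 y1 y2) by ring.
  replace (8 * M * r) with (2 * ((x2 - x1) + (y2 - y1)) * M) by (unfold x1, x2, y1, y2; ring).
  apply rint_bound; try lra.
  - intros z [[Z1 Z2] _]; apply Hc; unfold in_rect; lra.
  - intros z [[Z1 Z2] _].
    assert (L : Cmod (z - p) < d0).
    { eapply Rle_lt_trans; [apply Cmod_le_Re_Im|].
      change (Re (z - p)%C) with (Re z - Re p); change (Im (z - p)%C) with (Im z - Im p).
      assert (Rabs (Re z - Re p) <= r) by (apply Rabs_le; unfold x1, x2 in *; lra).
      assert (Rabs (Im z - Im p) <= r) by (apply Rabs_le; unfold y1, y2 in *; lra).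
      lra. }
    apply HM in L; pose proof (Cmod_triangle_rev (h z) (h p)); unfold M; lra.
Qed.

(** * Cauchy's formula *)

Lemma rcont_Cmod (f : C -> C) z : ccont f z -> rcont (fun x => Cmod (f x)) z.
Proof.
  intros H e He; generalize (H e He); apply near_imp; intros x Hx.
  pose proof (Cmod_triangle_rev (f x) (f z)); pose proof (Cmod_triangle_rev (f z) (f x)) as H2.
  rewrite (Cmod_minus_sym (f z)) in H2; apply Rabs_def1; lra.
Qed.

Lemma in_rect_closed a b c d : cclosed (in_rect a b c d).
Proof.
  intros w H; unfold in_rect.
  assert (G : forall eps, 0 < eps -> exists z, in_rect a b c d z /\
    Rabs (Re z - Re w) < eps /\ Rabs (Im z - Im w) < eps).
  { intros e He; destruct (H e He) as [z [Hz Hd]]; exists z; split; auto.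
    pose proof (re_le_Cmod (z - w)); pose proof (Im_le_Cmod (z - w)).
    change (Re (z - w)%C) with (Re z - Re w) in *; change (Im (z - w)%C) with (Im z - Im w) in *; lra. }
  repeat split; apply Rnot_lt_le; intros L.
  - destruct (G (a - Re w) ltac:(lra)) as [z [[Z1 Z2] [Z3 Z4]]]; apply Rabs_def2 in Z3; lra.
  - destruct (G (Re w - b) ltac:(lra)) as [z [[Z1 Z2] [Z3 Z4]]]; apply Rabs_def2 in Z3; lra.
  - destruct (G (c - Im w) ltac:(lra)) as [z [[Z1 Z2] [Z3 Z4]]]; apply Rabs_def2 in Z4; lra.
  - destruct (G (Im w - d) ltac:(lra)) as [z [[Z1 Z2] [Z3 Z4]]]; apply Rabs_def2 in Z4; lra.
Qed.

Lemma in_rect_bounded a b c d z : in_rect a b c d z ->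
  Cmod z <= (Rabs a + Rabs b) + (Rabs c + Rabs d).
Proof.
  intros [H1 H2]; eapply Rle_trans; [apply Cmod_le_Re_Im|].
  pose proof (Rle_abs a); pose proof (Rle_abs b); pose proof (Rle_abs c); pose proof (Rle_abs d).
  pose proof (Rle_abs (-a)) as A1; pose proof (Rle_abs (-b)) as A2; pose proof (Rle_abs (-c)) as A3; pose proof (Rle_abs (-d)) as A4.
  rewrite Rabs_Ropp in A1, A2, A3, A4.
  apply Rplus_le_compat; apply Rabs_le; lra.
Qed.

Lemma rect_bound (g : C -> C) a b c d : a <= b -> c <= d ->
  (forall z, in_rect a b c d z -> ccont g z) ->
  exists G, 0 <= G /\ forall z, in_rect a b c d z -> Cmod (g z) <= G.
Proof.
  intros Hab Hcd Hg.
  destruct (continuous_attains_max (fun z => Cmod (g z)) (in_rect a b c d)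
    ((Rabs a + Rabs b) + (Rabs c + Rabs d))) as [z [Hz HM]].
  - apply in_rect_closed.
  - apply in_rect_bounded.
  - exists (a, c); unfold in_rect; simpl; lra.
  - intros z Hz; apply rcont_Cmod; auto.
  - exists (Cmod (g z)); split; [apply Cmod_ge_0 | auto].
Qed.

Lemma edge_distance a b c d p : a < Re p < b -> c < Im p < d ->
  exists rho, 0 < rho /\ forall z, on_edge a b c d z -> rho <= Cmod (z - p)%C.
Proof.
  intros H1 H2.
  exists (Rmin (Rmin (Re p - a) (b - Re p)) (Rmin (Im p - c) (d - Im p))).
  split; [repeat apply Rmin_glb_lt; lra|].
  intros z [_ Hz].
  pose proof (Rmin_l (Rmin (Re p - a) (b - Re p)) (Rmin (Im p - c) (d - Im p))).
  pose proof (Rmin_r (Rmin (Re p - a) (b - Re p)) (Rmin (Im p - c) (d - Im p))).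
  pose proof (Rmin_l (Re p - a) (b - Re p)); pose proof (Rmin_r (Re p - a) (b - Re p)).
  pose proof (Rmin_l (Im p - c) (d - Im p)); pose proof (Rmin_r (Im p - c) (d - Im p)).
  pose proof (re_le_Cmod (z - p)) as A1; pose proof (Im_le_Cmod (z - p)) as A2.
  change (Re (z - p)%C) with (Re z - Re p) in A1; change (Im (z - p)%C) with (Im z - Im p) in A2.
  pose proof (Rle_abs (Re z - Re p)); pose proof (Rle_abs (Im z - Im p)).
  pose proof (Rle_abs (-(Re z - Re p))) as B1; pose proof (Rle_abs (-(Im z - Im p))) as B2.
  rewrite Rabs_Ropp in B1, B2; lra.
Qed.

(** Differentiation under the integral sign. A quadratic remainder, uniform on the edges, is assumed
    because Cauchy kernels provide one in closed form. *)
Lemma cder_rint_param (k : C -> C -> C) (k' : C -> C) a b c d p M : a <= b -> c <= d ->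
  near p (fun x => edge_cont (k x) a b c d) -> edge_cont k' a b c d ->
  near p (fun x => forall z, on_edge a b c d z ->
    Cmod (k x z - k p z - (x - p) * k' z)%C <= M * (Cmod (x - p)%C * Cmod (x - p)%C)) ->
  cder (fun x => rint (k x) a b c d) p (rint k' a b c d).
Proof.
  intros Hab Hcd Hk Hk' HM; apply cder_of_approx; intros e He.
  pose proof (near_self _ _ Hk) as Hp; simpl in Hp.
  (* Perimeter times bound, made positive by the added 1: for |x - p| < e / S the integrated
     remainder is at most e |x - p|. *)
  set (S := 2 * ((b - a) + (d - c)) * Rabs M + 1).
  assert (HS : 0 < S).
  { unfold S; pose proof (Rabs_pos M).
    assert (0 <= 2 * (b - a + (d - c)) * Rabs M) by (apply Rmult_le_pos; lra); lra. }
  generalize (near_and _ _ _ (near_and _ _ _ Hk HM) (near_ball p (e / S) ltac:(apply Rdiv_lt_0_compat; lra))).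
  apply near_imp; intros x [[Hx HMx] Hd].
  assert (E : (rint (k x) a b c d - rint (k p) a b c d - rint k' a b c d * (x - p))%C =
    rint (fun z => k x z + ((-(1)) * k p z + (-(x - p)) * k' z))%C a b c d).
  { rewrite (rint_plus (k x) (fun z => (-(1)) * k p z + (-(x - p)) * k' z)%C),
      (rint_plus (fun z => (-(1)) * k p z)%C (fun z => (-(x - p)) * k' z)%C),
      !rint_mult; auto; try ring;
    intros z Hz; repeat first [apply ccont_plus | apply ccont_mult | apply ccont_const]; auto. }
  rewrite E.
  pose proof (Cmod_ge_0 (x - p)).
  eapply Rle_trans.
  - apply rint_bound with (M := Rabs M * (Cmod (x - p) * Cmod (x - p))); auto.
    + intros z Hz; repeat first [apply ccont_plus | apply ccont_mult | apply ccont_const]; auto.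
    + intros z Hz.
      replace (k x z + (- (1) * k p z + - (x - p) * k' z))%C
        with (k x z - k p z - (x - p) * k' z)%C by ring.
      eapply Rle_trans; [now apply HMx|].
      apply Rmult_le_compat_r; [nra | apply Rle_abs].
  - apply Rmult_lt_compat_l with (r := S) in Hd; auto.
    replace (S * (e / S)) with e in Hd by (field; lra).
    replace (2 * (b - a + (d - c)) * (Rabs M * (Cmod (x - p) * Cmod (x - p))))
      with ((S - 1) * Cmod (x - p) * Cmod (x - p)) by (unfold S; ring).
    apply Rmult_le_compat_r; nra.
Qed.

Lemma near_half_distance (p : C) rho : 0 < rho ->
  near p (fun x => forall z, rho <= Cmod (z - p)%C ->
    (z - x)%C <> 0%C /\ (z - p)%C <> 0%C /\
    Cmod (/ (z - p))%C <= / rho /\ Cmod (/ (z - x))%C <= 2 * / rho).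
Proof.
  intros Hr; exists (rho / 2); split; [lra|]; intros x Hx z Hz.
  assert (H1 : rho / 2 <= Cmod (z - x)).
  { pose proof (Cmod_triangle_via z x p); lra. }
  assert (N1 : (z - x)%C <> 0%C) by (apply Cmod_gt_0; lra).
  assert (N2 : (z - p)%C <> 0%C) by (apply Cmod_gt_0; lra).
  repeat split; auto; rewrite Cmod_inv by auto.
  - apply Rinv_le_contravar; lra.
  - replace (2 * / rho) with (/ (rho / 2)) by (field; lra).
    apply Rinv_le_contravar; lra.
Qed.

(** Cauchy integrals without the factor 1 / (2 pi i), for the kernel 1 / (z - p) and its first two
    derivatives in [p]. These orders suffice to differentiate a function represented by [cauchy1]
    twice. *)
Definition cauchy1 (g : C -> C) a b c d (p : C) : C :=
  rint (fun z => g z * / (z - p))%C a b c d.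
Definition cauchy2 (g : C -> C) a b c d (p : C) : C :=
  rint (fun z => g z * (/ (z - p) * / (z - p)))%C a b c d.
Definition cauchy3 (g : C -> C) a b c d (p : C) : C :=
  rint (fun z => 2 * g z * (/ (z - p) * / (z - p) * / (z - p)))%C a b c d.

Lemma ccont_inv_minus (p z : C) : (z - p)%C <> 0%C -> ccont (fun z => / (z - p))%C z.
Proof.
  intros H; apply (ccont_inv (fun z => z - p)%C); auto.
  apply ccont_minus; [apply ccont_id | apply ccont_const].
Qed.

Lemma cder_cauchy1 (g : C -> C) a b c d p : a < Re p < b -> c < Im p < d ->
  (forall z, in_rect a b c d z -> ccont g z) ->
  cder (cauchy1 g a b c d) p (cauchy2 g a b c d p).
Proof.
  intros H1 H2 Hg.
  destruct (edge_distance a b c d p H1 H2) as [rho [Hr Hrho]].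
  destruct (rect_bound g a b c d ltac:(lra) ltac:(lra) Hg) as [G [HG0 HG]].
  pose proof (near_half_distance p rho Hr) as Hn.
  pose proof (near_self _ _ Hn) as Hp; simpl in Hp.
  apply cder_rint_param with (k := fun x z => (g z * / (z - x))%C)
    (M := G * (/ rho * / rho * (2 * / rho))); try lra.
  - generalize Hn; apply near_imp; intros x Hx z Hz.
    destruct (Hx z (Hrho z Hz)) as [N1 _].
    apply ccont_mult; [apply Hg, Hz | now apply ccont_inv_minus].
  - intros z Hz; destruct (Hp z (Hrho z Hz)) as [N1 _].
    apply ccont_mult; [apply Hg, Hz | apply ccont_mult; now apply ccont_inv_minus].
  - generalize Hn; apply near_imp; intros x Hx z Hz.
    destruct (Hx z (Hrho z Hz)) as [N1 [N2 [B1 B2]]].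
    (* The remainder of the kernel is exactly (x - p)^2 / ((z - p)^2 (z - x)); the constant [M]
       bounds it factor by factor, using [near_half_distance]. *)
    replace (g z * / (z - x) - g z * / (z - p) - (x - p) * (g z * (/ (z - p) * / (z - p))))%C
      with (g z * (/ (z - p) * / (z - p) * / (z - x)) * ((x - p) * (x - p)))%C by (field; auto).
    rewrite (Cmod_mult _ ((x - p) * (x - p))), (Cmod_mult (x - p)), (Cmod_mult (g z)), !Cmod_mult.
    apply Rmult_le_compat_r; [pose proof (Cmod_ge_0 (x - p)); nra|].
    repeat apply Rmult_le_compat; auto using Cmod_ge_0; try apply HG, Hz;
      repeat apply Rmult_le_pos; apply Cmod_ge_0.
Qed.

Lemma cder_cauchy2 (g : C -> C) a b c d p : a < Re p < b -> c < Im p < d ->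
  (forall z, in_rect a b c d z -> ccont g z) ->
  cder (cauchy2 g a b c d) p (cauchy3 g a b c d p).
Proof.
  intros H1 H2 Hg.
  destruct (edge_distance a b c d p H1 H2) as [rho [Hr Hrho]].
  destruct (rect_bound g a b c d ltac:(lra) ltac:(lra) Hg) as [G [HG0 HG]].
  pose proof (near_half_distance p rho Hr) as Hn.
  pose proof (near_self _ _ Hn) as Hp; simpl in Hp.
  apply cder_rint_param with (k := fun x z => (g z * (/ (z - x) * / (z - x)))%C)
    (M := G * (/ rho * / rho * (2 * / rho) * (2 * / rho + 2 * / rho))); try lra.
  - generalize Hn; apply near_imp; intros x Hx z Hz.
    destruct (Hx z (Hrho z Hz)) as [N1 _].
    apply ccont_mult; [apply Hg, Hz | apply ccont_mult; now apply ccont_inv_minus].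
  - intros z Hz; destruct (Hp z (Hrho z Hz)) as [N1 _].
    apply ccont_mult; [apply ccont_mult; [apply ccont_const | apply Hg, Hz] |].
    repeat apply ccont_mult; now apply ccont_inv_minus.
  - generalize Hn; apply near_imp; intros x Hx z Hz.
    destruct (Hx z (Hrho z Hz)) as [N1 [N2 [B1 B2]]].
    replace (g z * (/ (z - x) * / (z - x)) - g z * (/ (z - p) * / (z - p)) -
        (x - p) * (2 * g z * (/ (z - p) * / (z - p) * / (z - p))))%C
      with (g z * (/ (z - p) * / (z - p) * / (z - x) * (/ (z - x) + 2 * / (z - p))) *
        ((x - p) * (x - p)))%C by (field; auto).
    rewrite (Cmod_mult _ ((x - p) * (x - p))), (Cmod_mult (x - p)), (Cmod_mult (g z)).
    apply Rmult_le_compat_r; [pose proof (Cmod_ge_0 (x - p)); nra|].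
    rewrite (Cmod_mult (/ (z - p) * / (z - p) * / (z - x))), (Cmod_mult (/ (z - p) * / (z - p))), (Cmod_mult (/ (z - p))).
    assert (B3 : Cmod (/ (z - x) + 2 * / (z - p)) <= 2 * / rho + 2 * / rho).
    { eapply Rle_trans; [apply Cmod_triangle|].
      rewrite (Cmod_mult 2), Cmod_R, Rabs_pos_eq by lra; lra. }
    repeat apply Rmult_le_compat; auto using Cmod_ge_0; try apply HG, Hz;
      repeat apply Rmult_le_pos; apply Cmod_ge_0.
Qed.

Lemma Im_CRInt (g : R -> C) a b : ex_CRInt g a b -> is_RInt (fun t => Im (g t)) a b (Im (CRInt g a b)).
Proof.
  intros H; apply (is_RInt_fct_extend_snd (U := R_NormedModule) (V := R_NormedModule)).
  now apply (@RInt_correct C_R_CompleteNormedModule).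
Qed.

Lemma Re_CRInt (g : R -> C) a b : ex_CRInt g a b -> is_RInt (fun t => Re (g t)) a b (Re (CRInt g a b)).
Proof.
  intros H; apply (is_RInt_fct_extend_fst (U := R_NormedModule) (V := R_NormedModule)).
  now apply (@RInt_correct C_R_CompleteNormedModule).
Qed.

Lemma is_RInt_ge_const (g : R -> R) a b m l : a <= b -> is_RInt g a b l ->
  (forall t, a < t < b -> m <= g t) -> (b - a) * m <= l.
Proof.
  intros Hab H Hm.
  apply (is_RInt_le (fun _ => m) g a b); auto.
  apply (is_RInt_const (V := R_NormedModule)).
Qed.

Lemma Im_minus (x y : C) : Im (x - y)%C = Im x - Im y.
Proof. reflexivity. Qed.

Lemma Re_minus (x y : C) : Re (x - y)%C = Re x - Re y.
Proof. reflexivity. Qed.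

Lemma Im_Cinv (x y : R) : Im (/ (x, y))%C = - y / (x ^ 2 + y ^ 2).
Proof. reflexivity. Qed.

Lemma Re_Cinv (x y : R) : Re (/ (x, y))%C = x / (x ^ 2 + y ^ 2).
Proof. reflexivity. Qed.

(* The imaginary part is positive on each edge; the exact value [2 * PI] of the
   integral is never needed. *)
Lemma cauchy1_one_neq_0 a b c d p : a < Re p < b -> c < Im p < d ->
  cauchy1 (fun _ => RtoC 1) a b c d p <> 0%C.
Proof.
  intros H1 H2; unfold cauchy1.
  destruct (edge_distance a b c d p H1 H2) as [rho [Hr Hrho]].
  set (h := fun z => (1 * / (z - p))%C).
  assert (Hh : edge_cont h a b c d).
  { intros z Hz; apply ccont_mult; [apply ccont_const | apply ccont_inv_minus].
    apply Cmod_gt_0; specialize (Hrho z Hz); lra. }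
  destruct (edge_cont_ex h a b c d ltac:(lra) ltac:(lra) Hh) as (F1 & F2 & F3 & F4).
  destruct p as [p1 p2]; simpl in H1, H2.
  assert (Ih : forall x y, Im (h (x, y)) = (p2 - y) / ((x - p1) ^ 2 + (y - p2) ^ 2)).
  { intros x y; unfold h; rewrite Cmult_1_l.
    change ((x, y) - (p1, p2))%C with ((x + - p1, y + - p2) : C).
    rewrite Im_Cinv; f_equal; ring. }
  assert (Rh : forall x y, Re (h (x, y)) = (x - p1) / ((x - p1) ^ 2 + (y - p2) ^ 2)).
  { intros x y; unfold h; rewrite Cmult_1_l.
    change ((x, y) - (p1, p2))%C with ((x + - p1, y + - p2) : C).
    now rewrite Re_Cinv. }
  (* The squared diagonal dominates every denominator, so the relevant part of each integrand is
     bounded below by a positive constant. *)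
  set (L := ((b - a) * (b - a) + (d - c) * (d - c))).
  assert (HL : forall x y, a <= x <= b -> c <= y <= d -> (x, y) <> (p1, p2) ->
    0 < (x - p1) ^ 2 + (y - p2) ^ 2 <= L).
  { intros x y Hx Hy N; split.
    2:{ assert (0 <= ((b - a) - (x - p1)) * ((b - a) + (x - p1))) by (apply Rmult_le_pos; lra).
        assert (0 <= ((d - c) - (y - p2)) * ((d - c) + (y - p2))) by (apply Rmult_le_pos; lra).
        unfold L; lra. }
    destruct (Req_dec x p1) as [->|N1].
    - assert (y - p2 <> 0) by (intros E; apply N; f_equal; lra).
      assert (0 < (y - p2) ^ 2) by (apply pow2_gt_0; auto); nra.
    - assert (0 < (x - p1) ^ 2) by (apply pow2_gt_0; lra).
      pose proof (pow2_ge_0 (y - p2)); lra. }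
  assert (HL0 : 0 < L) by (unfold L; nra).
  assert (Q : forall u q, 0 < u -> 0 < q <= L -> u / L <= u / q).
  { intros u q Hu Hq; apply Rmult_le_compat_l; [lra|]; apply Rinv_le_contravar; lra. }
  assert (P : forall u v, 0 < u -> 0 < v -> 0 < v * (u / L)).
  { intros; apply Rmult_lt_0_compat; auto; now apply Rdiv_lt_0_compat. }
  (* On the vertical edges the factor [Ci] of [rint] turns real parts into imaginary parts. *)
  apply Im_CRInt in F1; apply Im_CRInt in F2; apply Re_CRInt in F3; apply Re_CRInt in F4.
  assert (B1 : 0 < Im (CRInt (fun x => h (x, c)) a b)).
  { eapply Rlt_le_trans; [apply (P (p2 - c) (b - a)); lra|].
    apply (is_RInt_ge_const (fun t => Im (h (t, c))) a b); auto; try lra.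
    intros t Ht; rewrite Ih; apply Q; [lra|]; apply HL; try lra; intros E; inversion E; lra. }
  assert (B2 : 0 < - Im (CRInt (fun x => h (x, d)) a b)).
  { eapply Rlt_le_trans; [apply (P (d - p2) (b - a)); lra|].
    apply (is_RInt_ge_const (fun t => - Im (h (t, d))) a b); try lra.
    { apply (is_RInt_opp (V := R_NormedModule)); auto. }
    intros t Ht; rewrite Ih.
    replace (- ((p2 - d) / ((t - p1) ^ 2 + (d - p2) ^ 2)))
      with ((d - p2) / ((t - p1) ^ 2 + (d - p2) ^ 2)) by (unfold Rdiv; ring).
    apply Q; [lra|]; apply HL; try lra; intros E; inversion E; lra. }
  assert (B3 : 0 < Re (CRInt (fun y => h (b, y)) c d)).
  { eapply Rlt_le_trans; [apply (P (b - p1) (d - c)); lra|].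
    apply (is_RInt_ge_const (fun t => Re (h (b, t))) c d); auto; try lra.
    intros t Ht; rewrite Rh; apply Q; [lra|]; apply HL; try lra; intros E; inversion E; lra. }
  assert (B4 : 0 < - Re (CRInt (fun y => h (a, y)) c d)).
  { eapply Rlt_le_trans; [apply (P (p1 - a) (d - c)); lra|].
    apply (is_RInt_ge_const (fun t => - Re (h (a, t))) c d); try lra.
    { apply (is_RInt_opp (V := R_NormedModule)); auto. }
    intros t Ht; rewrite Rh.
    replace (- ((a - p1) / ((a - p1) ^ 2 + (t - p2) ^ 2)))
      with ((p1 - a) / ((a - p1) ^ 2 + (t - p2) ^ 2)) by (unfold Rdiv; ring).
    apply Q; [lra|]; apply HL; try lra; intros E; inversion E; lra. }
  intros E; apply (f_equal Im) in E; revert E; unfold rint.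
  rewrite im_plus, im_mult, !Im_minus, Re_minus.
  change (Re Ci) with 0; change (Im Ci) with 1; change (Im (RtoC 0)) with 0; lra.
Qed.

Definition quot (f : C -> C) (l p z : C) : C :=
  if Ceq_dec z p then l else ((f z - f p) * / (z - p))%C.

Lemma quot_ccont f l p : cder f p l -> ccont (quot f l p) p.
Proof.
  intros [psi [H1 [H2 H3]]]; apply ccont_ext_near with psi; auto.
  generalize H3; apply near_imp; intros x E; unfold quot.
  destruct (Ceq_dec x p) as [->|N]; auto.
  rewrite E; apply Cminus_eq_contra in N; field; auto.
Qed.

Lemma quot_cder_away f l p z m : z <> p -> cder f z m -> exists q, cder (quot f l p) z q.
Proof.
  intros N H.
  exists ((m - 0) * / (z - p) + (f z - f p) * (- (1 - 0) / ((z - p) * (z - p))))%C.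
  apply cder_ext_near with (fun z => (f z - f p) * / (z - p))%C.
  - generalize (near_neq (fun x => x) z p (ccont_id z) N); apply near_imp.
    intros x Hx; unfold quot; now destruct (Ceq_dec x p).
  - apply (cder_mult (fun z => f z - f p)%C (fun z => / (z - p))%C).
    + apply (cder_minus f (fun _ => f p)); auto; apply cder_const.
    + apply (cder_inv (fun z => z - p)%C); [|now apply Cminus_eq_contra].
      apply (cder_minus (fun z => z) (fun _ => p)); [apply cder_id | apply cder_const].
Qed.

(** The difference quotient of [f] at [p], continuous there and differentiable elsewhere, integrates
    to zero. The integral of 1 / (z - p) stays as a factor, so that it only has to be non-zero. *)
Lemma cauchy_formula (f : C -> C) a b c d p : a < Re p < b -> c < Im p < d ->
  hol f (in_rect a b c d) ->
  (f p * cauchy1 (fun _ => RtoC 1) a b c d p = cauchy1 f a b c d p)%C.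
Proof.
  intros H1 H2 Hf.
  destruct (edge_distance a b c d p H1 H2) as [rho [Hr Hrho]].
  assert (N : forall z, on_edge a b c d z -> (z - p)%C <> 0%C).
  { intros z Hz; apply Cmod_gt_0; specialize (Hrho z Hz); lra. }
  destruct (Hf p) as [l Hl]; [unfold in_rect; lra|].
  assert (G : rint (quot f l p) a b c d = 0%C).
  { apply goursat_except with p; auto; [now apply quot_ccont|].
    intros z Hz Hn; destruct (Hf z Hz) as [m Hm]; eapply quot_cder_away; eauto. }
  assert (E : cauchy1 f a b c d p =
    rint (fun z => quot f l p z + f p * (1 * / (z - p)))%C a b c d).
  { apply rint_ext; try lra; intros z Hz; unfold quot; specialize (N z Hz).
    destruct (Ceq_dec z p) as [->|]; [|ring].
    exfalso; apply N; ring. }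
  rewrite E, (rint_plus (quot f l p) (fun z => f p * (1 * / (z - p)))%C); try lra.
  - rewrite G, (rint_mult (f p) (fun z => 1 * / (z - p))%C); try lra.
    + unfold cauchy1; ring.
    + intros z Hz; apply ccont_mult; [apply ccont_const | apply ccont_inv_minus; auto].
  - intros z Hz; destruct (Hf z) as [m Hm]; [apply Hz|].
    destruct (quot_cder_away f l p z m) as [q Hq]; auto; [|eapply cder_ccont; eauto].
    intros E'; apply (N z Hz); rewrite E'; ring.
  - intros z Hz; apply ccont_mult; [apply ccont_const|].
    apply ccont_mult; [apply ccont_const | apply ccont_inv_minus; auto].
Qed.

(** Near [p], [f] is a quotient [N / W] of Cauchy integrals over a small square, and both can be
    differentiated twice. The quotient rule carries the derivatives of [W] along, without its
    constancy being known. *)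
Lemma hol_derivative (f : C -> C) U : copen U -> hol f U -> hol (C_derive f) U.
Proof.
  intros HU Hf p Hp.
  destruct (HU p Hp) as [r [Hr HrU]].
  set (a := Re p - r / 8); set (b := Re p + r / 8).
  set (c := Im p - r / 8); set (d := Im p + r / 8).
  assert (Hrect : hol f (in_rect a b c d)).
  { intros z Hz; apply Hf, HrU.
    replace r with (2 * (r / 2)) by field.
    unfold in_rect in Hz; apply Cmod_rect_lt with a b c d; unfold a, b, c, d in *; lra. }
  assert (Cf : forall z, in_rect a b c d z -> ccont f z) by (intros z Hz; eapply hol_ccont; eauto).
  set (one := fun _ : C => RtoC 1).
  assert (C1 : forall z, in_rect a b c d z -> ccont one z) by (intros; apply ccont_const).
  set (W := cauchy1 one a b c d); set (W2 := cauchy2 one a b c d); set (W3 := cauchy3 one a b c d).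
  set (N := cauchy1 f a b c d); set (N2 := cauchy2 f a b c d); set (N3 := cauchy3 f a b c d).
  assert (Hin : near p (fun x => a < Re x < b /\ c < Im x < d)).
  { exists (r / 8); split; [lra|]; intros x Hx.
    pose proof (re_le_Cmod (x - p)) as A1; pose proof (Im_le_Cmod (x - p)) as A2.
    change (Re (x - p)%C) with (Re x - Re p) in A1; change (Im (x - p)%C) with (Im x - Im p) in A2.
    apply Rabs_le_between in A1; apply Rabs_le_between in A2; unfold a, b, c, d; lra. }
  assert (Hder : near p (fun x => ((N2 x * W x - N x * W2 x) / (W x * W x))%C = C_derive f x)).
  { generalize (near_trans _ _ Hin); apply near_imp; intros x Hx.
    pose proof (near_self _ _ Hx) as [X1 X2].
    symmetry; apply cder_C_derive.
    apply cder_ext_near with (fun y => N y / W y)%C.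
    - generalize Hx; apply near_imp; intros y [Y1 Y2].
      unfold N, W, one; rewrite <- cauchy_formula by auto.
      field; now apply cauchy1_one_neq_0.
    - apply (cder_div N W); [now apply cder_cauchy1 | now apply cder_cauchy1 | now apply cauchy1_one_neq_0]. }
  destruct (near_self _ _ Hin) as [P1 P2].
  assert (HW : W p <> 0%C) by now apply cauchy1_one_neq_0.
  eexists; eapply cder_ext_near; [exact Hder|].
  apply (cder_div (fun x => N2 x * W x - N x * W2 x)%C (fun x => W x * W x)%C);
    [| |now apply Cmult_neq_0].
  - apply (cder_minus (fun x => N2 x * W x)%C (fun x => N x * W2 x)%C).
    + apply (cder_mult N2 W); [apply cder_cauchy2 | apply cder_cauchy1]; auto.
    + apply (cder_mult N W2); [apply cder_cauchy1 | apply cder_cauchy2]; auto.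
  - apply (cder_mult W W); apply cder_cauchy1; auto.
Qed.

(** * The maximum principle and the Schwarz lemma *)

Lemma is_derive_Re_path (phi : C -> C) (p v l : C) (t : R) : cder phi (p + t * v)%C l ->
  is_derive (fun s : R => Re (phi (p + s * v)%C)) t (Re (l * v)%C).
Proof.
  intros H; apply is_derive_Reals; intros e He.
  set (k := Cmod v + 1); assert (Hk : 0 < k) by (unfold k; pose proof (Cmod_ge_0 v); lra).
  destruct (cder_approx _ _ _ H (e / k / 2)) as [d [Hd HA]].
  { repeat apply Rdiv_lt_0_compat; lra. }
  assert (Hdk : 0 < d / k) by now apply Rdiv_lt_0_compat.
  exists (mkposreal _ Hdk); intros h Hh0 Hh; simpl in Hh.
  assert (E : ((p + (t + h)%R * v) - (p + t * v) = h * v)%C) by (rewrite RtoC_plus; ring).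
  specialize (HA (p + (t + h)%R * v)%C); rewrite E, Cmod_mult, Cmod_R in HA.
  assert (Hv : Rabs h * Cmod v < d).
  { apply Rle_lt_trans with (Rabs h * k).
    - apply Rmult_le_compat_l; [apply Rabs_pos | unfold k; lra].
    - apply Rmult_lt_compat_r with (r := k) in Hh; auto.
      replace (d / k * k) with d in Hh by (field; lra); lra. }
  specialize (HA Hv).
  set (x := phi (p + (t + h)%R * v)%C) in *; set (y := phi (p + t * v)%C) in *.
  replace ((Re x - Re y) / h - Re (l * v)%C) with (Re (x - y - l * (h * v))%C / h).
  2:{ replace (l * (h * v))%C with (h * (l * v))%C by ring.
      rewrite !Re_minus, re_scal_l; field; auto. }
  rewrite Rabs_div by auto.
  assert (Ph : 0 < Rabs h) by now apply Rabs_pos_lt.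
  apply Rmult_lt_reg_r with (Rabs h); auto.
  replace (Rabs (Re (x - y - l * (h * v))%C) / Rabs h * Rabs h)
    with (Rabs (Re (x - y - l * (h * v))%C)) by (field; lra).
  eapply Rle_lt_trans; [apply re_le_Cmod|].
  eapply Rle_lt_trans; [apply HA|].
  replace (e / k / 2 * (Rabs h * Cmod v)) with (e * Rabs h / 2 * (Cmod v / k)) by (field; lra).
  assert (Cmod v / k <= 1).
  { apply Rmult_le_reg_r with k; auto.
    unfold Rdiv; rewrite Rmult_assoc, Rinv_l by lra; unfold k; lra. }
  assert (0 < e * Rabs h) by now apply Rmult_lt_0_compat.
  assert (e * Rabs h / 2 * (Cmod v / k) <= e * Rabs h / 2 * 1) by (apply Rmult_le_compat_l; lra).
  lra.
Qed.

Lemma Re_mult_opp_Ci (z : C) : Re (- Ci * z)%C = Im z.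
Proof. destruct z; unfold Ci, Cmult, Copp, Re, Im; simpl; ring. Qed.

Lemma is_derive_Im_path (phi : C -> C) (p v l : C) (t : R) : cder phi (p + t * v)%C l ->
  is_derive (fun s : R => Im (phi (p + s * v)%C)) t (Im (l * v)%C).
Proof.
  intros H.
  apply is_derive_ext with (fun s : R => Re ((fun z => - Ci * phi z)%C (p + s * v)%C)).
  { intros; apply Re_mult_opp_Ci. }
  rewrite <- Re_mult_opp_Ci, Cmult_assoc.
  apply (is_derive_Re_path (fun z => - Ci * phi z)%C).
  replace (- Ci * l)%C with (0 * phi (p + t * v) + - Ci * l)%C by ring.
  apply (cder_mult (fun _ => - Ci)%C phi); auto; apply cder_const.
Qed.

(** The real mean value inequality is applied to the real and the imaginary part separately, whence
    the factor 2. The range |t| <= 1 is the symmetric one that [bounded_variation] asks for. *)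
Lemma Cmod_increment (phi dphi : C -> C) (p v : C) (K : R) :
  (forall t : R, Rabs t <= 1 -> cder phi (p + t * v)%C (dphi (p + t * v)%C) /\
     Cmod (dphi (p + t * v)%C) <= K) ->
  Cmod (phi (p + v) - phi p)%C <= 2 * (K * Cmod v).
Proof.
  intros H.
  assert (E0 : (p + 0%R * v)%C = p) by ring.
  assert (E1 : (p + 1%R * v)%C = (p + v)%C) by ring.
  assert (HK : forall t : R, Rabs t <= 1 -> Cmod (dphi (p + t * v) * v)%C <= K * Cmod v).
  { intros t Ht; rewrite Cmod_mult; apply Rmult_le_compat_r; [apply Cmod_ge_0 | now apply H]. }
  assert (T : forall t, Rabs (t - 0) <= 1 -> Rabs t <= 1).
  { intros t; rewrite Rminus_0_r; auto. }
  assert (B1 := bounded_variation (fun s : R => Re (phi (p + s * v)%C))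
    (fun s : R => Re (dphi (p + s * v) * v)%C) (K * Cmod v) 0 1).
  assert (B2 := bounded_variation (fun s : R => Im (phi (p + s * v)%C))
    (fun s : R => Im (dphi (p + s * v) * v)%C) (K * Cmod v) 0 1).
  rewrite Rminus_0_r, Rabs_R1, E0, E1, <- Re_minus in B1.
  rewrite Rminus_0_r, Rabs_R1, E0, E1, <- Im_minus in B2.
  eapply Rle_trans; [apply Cmod_le_Re_Im|].
  replace (2 * (K * Cmod v)) with (K * Cmod v * 1 + K * Cmod v * 1) by ring.
  apply Rplus_le_compat; [apply B1 | apply B2]; intros t Ht;
    apply T in Ht; (split; [|eapply Rle_trans; [|exact (HK t Ht)]]).
  - apply is_derive_Re_path; now apply H.
  - apply re_le_Cmod.
  - apply is_derive_Im_path; now apply H.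
  - apply Im_le_Cmod.
Qed.

(** The remainder vanishes at [p] and its derivative is the first order error of f', which is o(|z -
    p|); integrating this along the segment through [Cmod_increment] gives o(|z - p|^2). The
    [eta / 2] absorbs the factor 2 there. *)
Lemma taylor2 (f : C -> C) U p : copen U -> hol f U -> U p -> forall eta, 0 < eta ->
  near p (fun x => Cmod (f x - f p - C_derive f p * (x - p)
    - C_derive (C_derive f) p / 2 * ((x - p) * (x - p)))%C <= eta * (Cmod (x - p)%C * Cmod (x - p)%C)).
Proof.
  intros HU Hf Hp eta He.
  set (l := C_derive f p); set (c := C_derive (C_derive f) p).
  pose proof (hol_C_derive _ _ _ (hol_derivative f U HU Hf) Hp) as H2; fold c in H2.
  destruct (near_and _ _ _ (HU p Hp) (cder_approx _ _ _ H2 (eta / 2) ltac:(lra))) as [d [Hd HH]].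
  exists d; split; auto; intros x Hx.
  set (v := (x - p)%C) in *.
  set (phi := fun z => (f z - f p - l * (z - p) - c / 2 * ((z - p) * (z - p)))%C).
  set (dphi := fun z => (C_derive f z - l - c * (z - p))%C).
  replace (f x - f p - l * v - c / 2 * (v * v))%C with (phi (p + v) - phi p)%C.
  2:{ unfold phi, v; replace (p + (x - p))%C with x by ring; field. }
  replace (eta * (Cmod v * Cmod v)) with (2 * (eta / 2 * Cmod v * Cmod v)) by field.
  apply Cmod_increment with dphi; intros t Ht.
  assert (E : (p + t * v - p = t * v)%C) by ring.
  assert (L : Cmod (p + t * v - p) <= Cmod v).
  { rewrite E, Cmod_mult, Cmod_R; pose proof (Cmod_ge_0 v); nra. }
  destruct (HH (p + t * v)%C) as [Hin HA]; [lra|].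
  split.
  - unfold dphi, phi; set (z := (p + t * v)%C) in *.
    replace (C_derive f z - l - c * (z - p))%C
      with (C_derive f z - 0 - (0 * (z - p) + l * (1 - 0))
        - (0 * ((z - p) * (z - p)) + c / 2 * ((1 - 0) * (z - p) + (z - p) * (1 - 0))))%C by field.
    assert (D1 : cder (fun z => z - p)%C z (1 - 0)%C)
      by (apply (cder_minus (fun z => z) (fun _ => p)); [apply cder_id | apply cder_const]).
    apply (cder_minus (fun z => f z - f p - l * (z - p))%C (fun z => c / 2 * ((z - p) * (z - p)))%C).
    + apply (cder_minus (fun z => f z - f p)%C (fun z => l * (z - p))%C).
      * apply (cder_minus f (fun _ => f p)); [now apply (hol_C_derive f U) | apply cder_const].
      * apply (cder_mult (fun _ => l) (fun z => z - p)%C); auto; apply cder_const.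
    + apply (cder_mult (fun _ => c / 2)%C (fun z => (z - p) * (z - p))%C); [apply cder_const|].
      apply (cder_mult (fun z => z - p)%C (fun z => z - p)%C); auto.
  - unfold dphi, l; eapply Rle_trans; [apply HA|].
    apply Rmult_le_compat_l; lra.
Qed.

Definition dquot (f : C -> C) (p : C) : C -> C := quot f (C_derive f p) p.

Lemma dquot_self f p : dquot f p p = C_derive f p.
Proof. unfold dquot, quot; now destruct (Ceq_dec p p). Qed.

Lemma dquot_neq f p z : z <> p -> dquot f p z = ((f z - f p) / (z - p))%C.
Proof. intros N; unfold dquot, quot; now destruct (Ceq_dec z p). Qed.

Lemma dquot_mult f p z : (dquot f p z * (z - p) = f z - f p)%C.
Proof.
  destruct (Ceq_dec z p) as [->|N]; [ring|].
  rewrite dquot_neq by auto; apply Cminus_eq_contra in N; field; auto.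
Qed.

(** Removability of the singularity at [p]: the second order expansion of [f], divided by [z - p],
    is a first order expansion of the quotient, with derivative f''(p) / 2. *)
Lemma hol_dquot f U p : copen U -> hol f U -> U p -> hol (dquot f p) U.
Proof.
  intros HU Hf Hp z Hz; destruct (Ceq_dec z p) as [->|N].
  - exists (C_derive (C_derive f) p / 2)%C; apply cder_of_approx; intros e He.
    generalize (taylor2 f U p HU Hf Hp e He); apply near_imp; intros x Hx.
    destruct (Ceq_dec x p) as [->|N].
    + replace (dquot f p p - dquot f p p - C_derive (C_derive f) p / 2 * (p - p))%C with (RtoC 0) by ring.
      rewrite Cmod_0, Cmod_minus_self; lra.
    + rewrite dquot_self, dquot_neq by auto; apply Cminus_eq_contra in N.
      assert (P : 0 < Cmod (x - p)) by now apply Cmod_gt_0.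
      apply Rmult_le_reg_r with (Cmod (x - p)); auto.
      rewrite <- Cmod_mult, Rmult_assoc.
      eapply Rle_trans; [|exact Hx]; right; f_equal; field; auto.
  - destruct (Hf z Hz) as [m Hm]; eapply quot_cder_away; eauto.
Qed.

Lemma ccont_conj f z : ccont f z -> ccont (fun x => Cconj (f x)) z.
Proof.
  intros Hf e He; generalize (Hf e He); apply near_imp; intros x Hx.
  now rewrite <- Cminus_conj, Cmod_conj.
Qed.

Lemma rcont_Re f z : ccont f z -> rcont (fun x => Re (f x)) z.
Proof.
  intros Hf e He; generalize (Hf e He); apply near_imp; intros x Hx.
  rewrite <- Re_minus; eapply Rle_lt_trans; [apply re_le_Cmod | auto].
Qed.

Lemma Re_mult_conj (z : C) : Re (z * Cconj z)%C = Cmod z ^ 2.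
Proof. rewrite Cmod2_alt; destruct z; simpl; ring. Qed.

(** The sums of u and of u^2 over the four points s i^k vanish, which removes the mixed terms A-B,
    A-D and B-D. The two points s and - s alone would leave the A-D term, of the critical order
    s^2. *)
Lemma four_point_sum (A B D : C) (s : R) :
  Cmod (A + B * s + D * (s * s))%C ^ 2 + Cmod (A + B * - s + D * (- s * - s))%C ^ 2 +
  (Cmod (A + B * (Ci * s) + D * (Ci * s * (Ci * s)))%C ^ 2 +
   Cmod (A + B * - (Ci * s) + D * (- (Ci * s) * - (Ci * s)))%C ^ 2) =
  4 * Cmod A ^ 2 + 4 * (s ^ 2 * Cmod B ^ 2) + 4 * (s ^ 4 * Cmod D ^ 2).
Proof.
  rewrite !Cmod2_alt; destruct A, B, D; unfold RtoC, Ci, Cplus, Cmult, Copp, Re, Im; simpl; ring.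
Qed.

Lemma Cmod_sqr_perturb (x y : C) (K e : R) : Cmod y <= K -> Cmod (x - y)%C <= e ->
  Cmod y ^ 2 - 2 * (K * e) <= Cmod x ^ 2.
Proof.
  intros H1 H2.
  pose proof (Cmod_triangle_rev y (y - x)) as H.
  replace (y - (y - x))%C with x in H by ring.
  rewrite (Cmod_minus_sym y x) in H.
  pose proof (Cmod_ge_0 x); pose proof (Cmod_ge_0 y); pose proof (Cmod_ge_0 (x - y)).
  assert (Cmod y * Cmod (x - y) <= K * e) by (apply Rmult_le_compat; auto).
  destruct (Rle_dec (Cmod (x - y)) (Cmod y)); nra.
Qed.

Lemma closed_disk_closed c r : cclosed (fun z => Cmod (z - c)%C <= r).
Proof.
  intros w H; apply Rnot_lt_le; intros L.
  destruct (H (Cmod (w - c) - r) ltac:(lra)) as [z [Hz Hd]].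
  pose proof (Cmod_triangle_via w z c); rewrite (Cmod_minus_sym w z) in *; lra.
Qed.

Lemma disk_bounded c r z : Cmod (z - c)%C <= r -> Cmod z <= r + Cmod c.
Proof. pose proof (Cmod_triangle_rev z c); lra. Qed.

(* A maximum of [|F|^2 + eps |z - c|^2] cannot be interior: averaging over the
   four points [z + s i^k] cancels the cross terms of [F z] with the first and
   second order terms of [F], so [|F|^2] loses at most [o(s^2)], while the other
   summand gains [eps s^2]. *)
Lemma maximum_principle (F : C -> C) U (c : C) (r M : R) : copen U -> hol F U -> 0 < r ->
  (forall z, Cmod (z - c)%C <= r -> U z) ->
  (forall z, Cmod (z - c)%C = r -> Cmod (F z) <= M) ->
  forall z, Cmod (z - c)%C <= r -> Cmod (F z) <= M.
Proof.
  intros HU HF Hr HrU HM z Hz.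
  assert (HM0 : 0 <= M).
  { eapply Rle_trans; [apply Cmod_ge_0 | apply (HM (c + r)%C)].
    replace (c + r - c)%C with (RtoC r) by ring; rewrite Cmod_R; apply Rabs_pos_eq; lra. }
  assert (Key : forall eps, 0 < eps -> Cmod (F z) ^ 2 <= M ^ 2 + eps * r ^ 2).
  { intros eps He.
    set (v := fun z => Cmod (F z) ^ 2 + eps * Cmod (z - c)%C ^ 2).
    destruct (continuous_attains_max v (fun z => Cmod (z - c) <= r) (r + Cmod c)) as [p [Hp Hmax]].
    - apply closed_disk_closed.
    - apply disk_bounded.
    - exists z; auto.
    - intros x Hx.
      assert (R1 : rcont (fun z => Re (F z * Cconj (F z) + eps * ((z - c) * Cconj (z - c)))%C) x).
      { apply rcont_Re.
        assert (ccont F x) by (apply (hol_ccont F U); auto).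
        assert (ccont (fun z => z - c)%C x) by (apply ccont_minus; [apply ccont_id | apply ccont_const]).
        apply ccont_plus; [|apply ccont_mult; [apply ccont_const|]];
          apply ccont_mult; auto; now apply ccont_conj. }
      intros e He'; generalize (R1 e He'); apply near_imp; intros y.
      rewrite !re_plus, !re_scal_l, !Re_mult_conj; auto.
    - assert (Hpr : Cmod (p - c) = r).
      { apply Rle_antisym; auto; apply Rnot_lt_le; intros L.
        set (A := F p); set (B := C_derive F p); set (D := (C_derive (C_derive F) p / 2)%C).
        set (K := Cmod A + Cmod B + Cmod D).
        pose proof (Cmod_ge_0 A) as PA; pose proof (Cmod_ge_0 B) as PB; pose proof (Cmod_ge_0 D) as PD.
        assert (HK : 0 <= K) by (unfold K; lra).
        (* [K] bounds the Taylor polynomial for |u| = s <= 1. With this [eta] each point loses at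
           most eps s^2 / 2 to the remainder, less than its mean gain eps s^2. *)
        set (eta := eps / (4 * (K + 1))).
        assert (Heta : 0 < eta) by (apply Rdiv_lt_0_compat; lra).
        destruct (taylor2 F U p HU HF (HrU p Hp) eta Heta) as [d [Hd HT]].
        set (s := Rmin (Rmin (d / 2) 1) (r - Cmod (p - c))).
        assert (Hs : 0 < s) by (unfold s; repeat apply Rmin_glb_lt; lra).
        assert (s < d /\ s <= 1 /\ s <= r - Cmod (p - c)) as (S1 & S2 & S3).
        { assert (s <= Rmin (d / 2) 1) by apply Rmin_l.
          assert (s <= r - Cmod (p - c)) by apply Rmin_r.
          pose proof (Rmin_l (d / 2) 1); pose proof (Rmin_r (d / 2) 1); lra. }
        assert (Pt : forall u, Cmod u = s ->
          Cmod (A + B * u + D * (u * u))%C ^ 2 - 2 * (K * (eta * s ^ 2)) +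
            eps * Cmod ((p - c) + 1 * u + 0 * (u * u))%C ^ 2 <= v p).
        { intros u Hu.
          assert (Hin : Cmod (p + u - c) <= r).
          { replace (p + u - c)%C with ((p - c) + u)%C by ring.
            pose proof (Cmod_triangle (p - c) u); lra. }
          eapply Rle_trans; [|apply (Hmax (p + u)%C Hin)]; unfold v.
          replace ((p - c) + 1 * u + 0 * (u * u))%C with (p + u - c)%C by ring.
          apply Rplus_le_compat_r.
          apply Cmod_sqr_perturb.
          - eapply Rle_trans; [apply Cmod_triangle|].
            eapply Rle_trans; [apply Rplus_le_compat_r, Cmod_triangle|].
            rewrite !Cmod_mult, Hu; unfold K.
            assert (Cmod B * s <= Cmod B) by nra.
            assert (s * s <= 1) by nra.
            assert (Cmod D * (s * s) <= Cmod D) by nra.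
            lra.
          - assert (E : (p + u - p)%C = u) by ring.
            specialize (HT (p + u)%C); rewrite E, Hu in HT; specialize (HT S1).
            fold A B D in HT; replace (s ^ 2) with (s * s) by ring.
            replace (F (p + u) - (A + B * u + D * (u * u)))%C
              with (F (p + u) - A - B * u - D * (u * u))%C by ring; auto. }
        assert (M1 : Cmod s = s) by (rewrite Cmod_R; apply Rabs_pos_eq; lra).
        assert (M2 : Cmod (Ci * s) = s) by (rewrite Cmod_mult, Cmod_Ci, M1; ring).
        pose proof (Pt s M1) as Q1.
        pose proof (Pt (- s)%C ltac:(rewrite Cmod_opp; auto)) as Q2.
        pose proof (Pt (Ci * s)%C M2) as Q3.
        pose proof (Pt (- (Ci * s))%C ltac:(rewrite Cmod_opp; auto)) as Q4.
        pose proof (four_point_sum A B D s) as S4.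
        (* The same identity for the polynomial (p - c) + u computes the gain of the term eps |z -
           c|^2. *)
        pose proof (four_point_sum (p - c) 1 0 s) as S5.
        rewrite Cmod_1, Cmod_0 in S5.
        assert (0 <= s ^ 2 * Cmod B ^ 2) by (apply Rmult_le_pos; apply pow_le; lra).
        assert (0 <= s ^ 4 * Cmod D ^ 2) by (apply Rmult_le_pos; apply pow_le; lra).
        assert (Eta : 4 * ((K + 1) * eta) = eps) by (unfold eta; field; lra).
        assert (P2 : 0 < s ^ 2) by (apply pow_lt; lra).
        unfold v in Q1, Q2, Q3, Q4; fold A in Q1, Q2, Q3, Q4.
        assert (2 * (K * (eta * s ^ 2)) < eps * s ^ 2).
        { replace (2 * (K * (eta * s ^ 2))) with (2 * (K * eta) * s ^ 2) by ring.
          apply Rmult_lt_compat_r; auto; nra. }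
        nra. }
      pose proof (Hmax z Hz) as Hv; unfold v in Hv.
      rewrite Hpr in Hv.
      specialize (HM p Hpr).
      pose proof (pow2_ge_0 (Cmod (z - c))).
      assert (Cmod (F p) ^ 2 <= M ^ 2) by (apply pow_incr; split; [apply Cmod_ge_0 | auto]).
      nra. }
  apply Rnot_lt_le; intros L.
  set (q := Cmod (F z) ^ 2 - M ^ 2).
  assert (Hq : 0 < q) by (unfold q; nra).
  assert (Hr2 : 0 < r ^ 2) by (apply pow_lt; lra).
  specialize (Key (q / (2 * r ^ 2)) ltac:(apply Rdiv_lt_0_compat; lra)).
  replace (q / (2 * r ^ 2) * r ^ 2) with (q / 2) in Key by (field; lra).
  unfold q in *; lra.
Qed.

Lemma unit_disk_open : copen unit_disk.
Proof.
  intros z Hz; unfold unit_disk in *; exists (1 - Cmod z); split; [lra|].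
  intros x Hx; pose proof (Cmod_triangle_rev x z); lra.
Qed.

(** [Phi z / z], extended by [dquot], is at most 1 / rho on the circle of radius rho, hence inside
    it; then rho tends to 1. *)
Lemma schwarz (Phi : C -> C) : hol Phi unit_disk -> Phi 0%C = 0%C ->
  (forall z, unit_disk z -> Cmod (Phi z) <= 1) ->
  forall z, unit_disk z -> Cmod (Phi z) <= Cmod z.
Proof.
  intros HP H0 H1 z Hz.
  assert (D0 : unit_disk 0) by (unfold unit_disk; rewrite Cmod_0; lra).
  assert (HQ : forall rho, Cmod z < rho < 1 -> Cmod (dquot Phi 0 z) <= / rho).
  { intros rho Hrho; pose proof (Cmod_ge_0 z).
    assert (E : forall w : C, (w - 0 = w)%C) by (intros; ring).
    apply (maximum_principle (dquot Phi 0) unit_disk 0 rho); try (rewrite E); try lra.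
    - apply unit_disk_open.
    - apply hol_dquot; auto; apply unit_disk_open.
    - intros w; rewrite E; unfold unit_disk; lra.
    - intros w; rewrite E; intros Hw.
      assert (Nw : w <> 0%C) by (apply Cmod_gt_0; lra).
      rewrite dquot_neq, H0, !E, Cmod_div, Hw by auto.
      assert (Cmod (Phi w) <= 1) by (apply H1; unfold unit_disk; lra).
      pose proof (Rinv_0_lt_compat rho ltac:(lra)); unfold Rdiv; nra. }
  assert (E : Phi z = (dquot Phi 0 z * z)%C).
  { transitivity (dquot Phi 0 z * (z - 0))%C; [rewrite dquot_mult, H0; ring | ring]. }
  rewrite E, Cmod_mult.
  unfold unit_disk in Hz.
  assert (Q1 : Cmod (dquot Phi 0 z) <= 1).
  { apply Rnot_lt_le; intros L.
    set (q := Cmod (dquot Phi 0 z)) in *.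
    pose proof (Cmod_ge_0 z).
    (* A radius below 1 that exceeds both [Cmod z] and [/ q]; the bound q <= 1 / rho < q is then
       absurd. *)
    set (rho := Rmax ((1 + / q) / 2) ((1 + Cmod z) / 2)).
    assert (Hq : / q < 1) by (rewrite <- Rinv_1; apply Rinv_lt_contravar; lra).
    assert (Hrho : rho < 1) by (unfold rho; apply Rmax_lub_lt; lra).
    assert ((1 + / q) / 2 <= rho) by apply Rmax_l.
    assert ((1 + Cmod z) / 2 <= rho) by apply Rmax_r.
    specialize (HQ rho ltac:(lra)).
    assert (Pq : 0 < / q) by (apply Rinv_0_lt_compat; lra).
    assert (/ q < rho) by lra.
    assert (/ rho < / / q) by (apply Rinv_lt_contravar; [apply Rmult_lt_0_compat|]; lra).
    rewrite Rinv_inv in *; lra. }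
  pose proof (Cmod_ge_0 z); nra.
Qed.

(** * Injective holomorphic maps *)

Definition inj_on (f : C -> C) (U : C -> Prop) : Prop :=
  forall z1 z2, U z1 -> U z2 -> f z1 = f z2 -> z1 = z2.

Lemma closed_disk_in_open U p rho : copen U -> U p -> 0 < rho ->
  exists r, 0 < r < rho /\ forall z, Cmod (z - p)%C <= r -> U z.
Proof.
  intros HU Hp Hrho; destruct (HU p Hp) as [d [Hd HH]].
  exists (Rmin d rho / 2).
  pose proof (Rmin_l d rho); pose proof (Rmin_r d rho).
  assert (0 < Rmin d rho) by now apply Rmin_glb_lt.
  split; [lra|]; intros z Hz; apply HH; lra.
Qed.

Lemma circle_closed c r : cclosed (fun z => Cmod (z - c)%C = r).
Proof.
  intros w H; apply Rle_antisym.
  - apply (closed_disk_closed c r); intros e He; destruct (H e He) as [z [Hz Hd]].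
    exists z; split; auto; lra.
  - apply Rnot_lt_le; intros L.
    destruct (H (r - Cmod (w - c)) ltac:(lra)) as [z [Hz Hd]].
    pose proof (Cmod_triangle_via z w c); lra.
Qed.

Lemma circle_min (f : C -> C) U p r : hol f U -> inj_on f U -> 0 < r ->
  (forall z, Cmod (z - p)%C <= r -> U z) ->
  exists m, 0 < m /\ forall z, Cmod (z - p)%C = r -> m <= Cmod (f z - f p)%C.
Proof.
  intros Hf Hinj Hr HU.
  destruct (continuous_attains_max (fun z => - Cmod (f z - f p)%C) (fun z => Cmod (z - p) = r) (r + Cmod p))
    as [z0 [Hz0 Hmax]].
  - apply circle_closed.
  - intros z Hz; apply disk_bounded; lra.
  - exists (p + r)%C; replace (p + r - p)%C with (RtoC r) by ring.
    rewrite Cmod_R; apply Rabs_pos_eq; lra.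
  - intros z Hz e He.
    assert (H : ccont (fun z => f z - f p)%C z).
    { apply ccont_minus; [|apply ccont_const]; apply (hol_ccont f U); auto; apply HU; lra. }
    generalize (rcont_Cmod _ _ H e He); apply near_imp; intros x Hx.
    replace (- Cmod (f x - f p) - - Cmod (f z - f p)) with (- (Cmod (f x - f p) - Cmod (f z - f p))) by ring.
    now rewrite Rabs_Ropp.
  - exists (Cmod (f z0 - f p)); split.
    + apply Cmod_gt_0, Cminus_eq_contra; intros E.
      apply Hinj in E; [|apply HU; lra | apply HU; rewrite Cmod_minus_self; lra].
      rewrite E, Cmod_minus_self in Hz0; lra.
    + intros z Hz; specialize (Hmax z Hz); simpl in Hmax; lra.
Qed.

(** Otherwise [f] takes equal values at two distinct points near [p]. This supplies the points [a]
    near [p] with f' a <> 0 for the argument that follows. *)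
Lemma derivative_not_locally_zero (f : C -> C) U p : hol f U -> inj_on f U ->
  near p U -> ~ near p (fun x => C_derive f x = 0%C).
Proof.
  intros Hf Hinj HU H0.
  destruct (near_and _ _ _ HU H0) as [d [Hd HH]].
  set (v := RtoC (d / 2)).
  assert (Hv : Cmod v = d / 2) by (unfold v; rewrite Cmod_R; apply Rabs_pos_eq; lra).
  assert (E : Cmod (f (p + v) - f p)%C <= 2 * (0 * Cmod v)).
  { apply Cmod_increment with (dphi := C_derive f); intros t Ht.
    destruct (HH (p + t * v)%C) as [H1 H2].
    { replace (p + t * v - p)%C with (t * v)%C by ring.
      rewrite Cmod_mult, Cmod_R, Hv; nra. }
    split; [now apply (hol_C_derive f U)|].
    rewrite H2, Cmod_0; lra. }
  pose proof (Cmod_ge_0 (f (p + v) - f p)%C).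
  assert (E0 : (f (p + v) - f p)%C = 0%C) by (apply Cmod_eq_0; lra).
  apply Ceq_minus, Hinj in E0.
  - assert (v = 0%C) as E1 by (replace v with (p + v - p)%C by ring; rewrite E0; ring).
    rewrite E1, Cmod_0 in Hv; lra.
  - apply HH; replace (p + v - p)%C with v by ring; lra.
  - apply HH; rewrite Cmod_minus_self; lra.
Qed.

(* Hurwitz's argument: for [a] near [p] with [f' a <> 0] the difference quotient
   of [f] at [a] has no zero, so its modulus at [p] is bounded below by its
   minimum on a fixed circle, uniformly in [a]. *)
Lemma injective_derivative_neq_0 (f : C -> C) U p : copen U -> hol f U -> inj_on f U -> U p ->
  C_derive f p <> 0%C.
Proof.
  intros HU Hf Hinj Hp H0.
  destruct (closed_disk_in_open U p 1 HU Hp ltac:(lra)) as [r [[Hr _] HrU]].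
  destruct (circle_min f U p r Hf Hinj Hr HrU) as [m [Hm Hmin]].
  (* On the circle |f z - f a| >= m / 2 and |z - a| <= 2 r, so the quotient at [p] will be at least
     m / (4 r). Half of this is the error allowed in f' p = 0. *)
  assert (Hm8 : 0 < m / (8 * r)) by (apply Rdiv_lt_0_compat; lra).
  assert (Cp : ccont f p) by now apply (hol_ccont f U).
  pose proof (cder_approx _ _ _ (hol_C_derive f U p Hf Hp) _ Hm8) as HA.
  pose proof (near_and _ _ _ HA (near_and _ _ _ (Cp (m / 2) ltac:(lra)) (near_ball p r Hr))) as HN.
  apply (derivative_not_locally_zero f U p Hf Hinj (HU p Hp)).
  generalize HN; apply near_imp; intros a [A1 [A2 A3]].
  destruct (Ceq_dec a p) as [->|Na]; auto.
  apply NNPP; intros Da.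
  assert (Ua : U a) by (apply HrU; lra).
  assert (Hnz : forall z, U z -> dquot f a z <> 0%C).
  { intros z Hz; destruct (Ceq_dec z a) as [->|N]; [now rewrite dquot_self|].
    intros E; pose proof (dquot_mult f a z) as E2; rewrite E in E2.
    apply N, Hinj; auto; apply Ceq_minus; rewrite <- E2; ring. }
  assert (B : Cmod (/ dquot f a p)%C <= 4 * r / m).
  { apply (maximum_principle (fun z => / dquot f a z)%C U p r); auto.
    - intros z Hz; destruct (hol_dquot f U a HU Hf Ua z Hz) as [q Hq].
      eexists; apply cder_inv; eauto.
    - intros z Hz.
      assert (Uz : U z) by (apply HrU; lra).
      rewrite Cmod_inv by auto.
      assert (L : m / (4 * r) <= Cmod (dquot f a z)).
      { assert (H1 : m / 2 <= Cmod (f z - f a)).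
        { specialize (Hmin z Hz); pose proof (Cmod_triangle_via (f z) (f a) (f p)); lra. }
        assert (H2 : Cmod (z - a) <= 2 * r).
        { pose proof (Cmod_triangle_via z p a); rewrite (Cmod_minus_sym p a) in *; lra. }
        rewrite <- dquot_mult, Cmod_mult in H1.
        apply Rmult_le_reg_r with (2 * r); [lra|].
        replace (m / (4 * r) * (2 * r)) with (m / 2) by (field; lra).
        pose proof (Cmod_ge_0 (dquot f a z)); nra. }
      replace (4 * r / m) with (/ (m / (4 * r))) by (field; lra).
      apply Rinv_le_contravar; auto; apply Rdiv_lt_0_compat; lra.
    - rewrite Cmod_minus_self; lra. }
  assert (Hpa : 0 < Cmod (a - p)) by (apply Cmod_gt_0; now apply Cminus_eq_contra).
  rewrite Cmod_inv in B by auto.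
  assert (Pd : 0 < Cmod (dquot f a p)) by (apply Cmod_gt_0; auto).
  assert (B2 : m / (4 * r) <= Cmod (dquot f a p)).
  { rewrite <- (Rinv_inv (m / (4 * r))), <- (Rinv_inv (Cmod (dquot f a p))).
    apply Rinv_le_contravar; [now apply Rinv_0_lt_compat|].
    replace (/ (m / (4 * r))) with (4 * r / m) by (field; lra); auto. }
  rewrite H0 in A1.
  replace (f a - f p - 0 * (a - p))%C with (- (f p - f a))%C in A1 by ring.
  rewrite Cmod_opp, <- dquot_mult, Cmod_mult, (Cmod_minus_sym p a) in A1.
  replace (m / (4 * r)) with (2 * (m / (8 * r))) in B2 by (field; lra).
  nra.
Qed.

(** If [w] were omitted on the closed disk of radius r, the maximum principle for 1 / (f - w) would
    give |f p - w| >= m / 2, where m is the minimum of |f - f p| on the circle. *)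
Lemma injective_open_mapping (f : C -> C) U p rho : copen U -> hol f U -> inj_on f U -> U p ->
  0 < rho -> near (f p) (fun w => exists z, U z /\ Cmod (z - p)%C < rho /\ f z = w).
Proof.
  intros HU Hf Hinj Hp Hrho.
  destruct (closed_disk_in_open U p rho HU Hp Hrho) as [r [[Hr Hr2] HrU]].
  destruct (circle_min f U p r Hf Hinj Hr HrU) as [m [Hm Hmin]].
  exists (m / 2); split; [lra|]; intros w Hw; apply NNPP; intros N.
  assert (Nw : forall z, Cmod (z - p) <= r -> f z <> w).
  { intros z Hz E; apply N; exists z; repeat split; auto; lra. }
  assert (P0 : Cmod (p - p) <= r) by (rewrite Cmod_minus_self; lra).
  assert (B : Cmod (/ (f p - w))%C <= 2 / m).
  { apply (maximum_principle (fun z => / (f z - w))%C (fun z => U z /\ f z <> w) p r); auto.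
    - intros z [H1 H2]; apply near_and; [now apply HU | apply near_neq; auto].
      now apply (hol_ccont f U).
    - intros z [H1 H2]; destruct (Hf z H1) as [l Hl].
      eexists; apply (cder_inv (fun z => f z - w)%C); [|now apply Cminus_eq_contra].
      apply (cder_minus f (fun _ => w)); [exact Hl | apply cder_const].
    - intros z Hz.
      rewrite Cmod_inv by (apply Cminus_eq_contra, Nw; lra).
      replace (2 / m) with (/ (m / 2)) by (field; lra).
      apply Rinv_le_contravar; [lra|].
      specialize (Hmin z Hz); pose proof (Cmod_triangle_via (f z) w (f p)); lra. }
  assert (Np : (f p - w)%C <> 0%C) by (apply Cminus_eq_contra; auto).
  rewrite Cmod_inv, Cmod_minus_sym in B by auto.
  assert (0 < Cmod (w - f p)) by (rewrite Cmod_minus_sym; now apply Cmod_gt_0).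
  assert (/ (m / 2) < / Cmod (w - f p)) by (apply Rinv_lt_contravar; [apply Rmult_lt_0_compat|]; lra).
  replace (/ (m / 2)) with (2 / m) in * by (field; lra); lra.
Qed.

(** Hilbert's epsilon makes the inverse total; off the image of [U] its value is arbitrary. *)
Definition inverse_on (f : C -> C) (U : C -> Prop) (w : C) : C :=
  epsilon (inhabits (RtoC 0)) (fun z => U z /\ f z = w).

Lemma inverse_on_spec f U w : (exists z, U z /\ f z = w) ->
  U (inverse_on f U w) /\ f (inverse_on f U w) = w.
Proof. exact (epsilon_spec (inhabits (RtoC 0)) (fun z => U z /\ f z = w)). Qed.

Lemma inverse_on_left f U z : inj_on f U -> U z -> inverse_on f U (f z) = z.
Proof.
  intros Hinj Hz; destruct (inverse_on_spec f U (f z)) as [H1 H2]; [eauto | auto].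
Qed.

(** If [psi] is the slope function of [f] at [p], then [1 / psi (g w)] is one for the inverse [g].
    Its continuity is the open mapping property, and psi p = f' p is non-zero. *)
Lemma cder_inverse_on (f : C -> C) U p : copen U -> hol f U -> inj_on f U -> U p ->
  cder (inverse_on f U) (f p) (/ C_derive f p)%C.
Proof.
  intros HU Hf Hinj Hp.
  set (g := inverse_on f U).
  assert (Egp : g (f p) = p) by now apply inverse_on_left.
  assert (Cg : ccont g (f p)).
  { intros e He; rewrite Egp.
    generalize (injective_open_mapping f U p e HU Hf Hinj Hp He); apply near_imp.
    intros w [z [Hz [Hd <-]]]; unfold g; now rewrite inverse_on_left. }
  pose proof (injective_derivative_neq_0 f U p HU Hf Hinj Hp) as Hnz.
  destruct (hol_C_derive f U p Hf Hp) as [psi [P1 [P2 P3]]].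
  exists (fun w => / psi (g w))%C.
  assert (Cpsi : ccont (fun w => psi (g w)) (f p)) by (apply (ccont_comp g psi); auto; now rewrite Egp).
  assert (Hn0 : psi (g (f p)) <> 0%C) by now rewrite Egp, P2.
  repeat split.
  - now apply ccont_inv.
  - now rewrite Egp, P2.
  - destruct P3 as [d [Hd P3]].
    generalize (near_and _ _ _ (near_and _ _ _ (Cg d Hd) (near_neq _ _ _ Cpsi Hn0))
      (injective_open_mapping f U p d HU Hf Hinj Hp Hd)); apply near_imp.
    intros w [[H1 H2] [z [Hz [_ Hw]]]]; rewrite Egp in *.
    assert (E : f (g w) = w) by (apply inverse_on_spec; eauto).
    specialize (P3 _ H1); rewrite E in P3; rewrite P3; field; auto.
Qed.

(** * The Schwarz-Pick inequality and rigidity of the real part *)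

(** Schwarz's lemma after the disk automorphism that moves [Phi 0] to 0. In this form without
    division, both sides squared are polynomials in the coordinates, ready to be differentiated in a
    parameter. *)
Lemma schwarz_pick (Phi : C -> C) : hol Phi unit_disk ->
  (forall z, unit_disk z -> unit_disk (Phi z)) ->
  forall z, unit_disk z ->
  Cmod (Phi z - Phi 0%C)%C <= Cmod z * Cmod (1 - Cconj (Phi 0%C) * Phi z)%C.
Proof.
  intros HP HD z Hz.
  assert (D0 : unit_disk 0) by (unfold unit_disk; rewrite Cmod_0; lra).
  set (b := Phi 0%C); assert (Hb : Cmod b < 1) by apply (HD _ D0).
  assert (Hden : forall x, unit_disk x -> (1 - Cconj b * Phi x)%C <> 0%C).
  { intros x Hx; apply Cmod_gt_0.
    pose proof (Cmod_triangle_rev 1 (Cconj b * Phi x)) as H.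
    rewrite Cmod_1, Cmod_mult, Cmod_conj in H.
    pose proof (HD x Hx) as Hx'; unfold unit_disk in Hx'.
    pose proof (Cmod_ge_0 b); pose proof (Cmod_ge_0 (Phi x)); nra. }
  assert (S := schwarz (fun x => (Phi x - b) / (1 - Cconj b * Phi x))%C).
  simpl in S.
  assert (Q : Cmod ((Phi z - b) / (1 - Cconj b * Phi z))%C <= Cmod z).
  { apply S; auto.
    - intros x Hx; destruct (HP x Hx) as [l Hl]; eexists.
      apply (cder_div (fun x => Phi x - b)%C (fun x => 1 - Cconj b * Phi x)%C); [| |now apply Hden].
      + apply (cder_minus Phi (fun _ => b)); [exact Hl | apply cder_const].
      + apply (cder_minus (fun _ => RtoC 1) (fun x => Cconj b * Phi x)%C); [apply cder_const|].
        apply (cder_mult (fun _ => Cconj b) Phi); [apply cder_const | exact Hl].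
    - fold b; replace (b - b)%C with (RtoC 0) by ring; unfold Cdiv; ring.
    - intros x Hx; rewrite Cmod_div by auto.
      assert (P : 0 < Cmod (1 - Cconj b * Phi x)) by (apply Cmod_gt_0; auto).
      apply Rmult_le_reg_r with (Cmod (1 - Cconj b * Phi x)); auto.
      unfold Rdiv; rewrite Rmult_assoc, Rinv_l, Rmult_1_l, Rmult_1_r by lra.
      assert (I : Cmod (1 - Cconj b * Phi x) ^ 2 - Cmod (Phi x - b) ^ 2 =
        (1 - Cmod b ^ 2) * (1 - Cmod (Phi x) ^ 2)).
      { rewrite !Cmod2_alt; destruct b, (Phi x); unfold Cconj, RtoC, Cminus, Cplus, Copp, Cmult, Re, Im; simpl; ring. }
      pose proof (HD x Hx) as Hx'; unfold unit_disk in Hx'.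
      pose proof (Cmod_ge_0 b); pose proof (Cmod_ge_0 (Phi x)); pose proof (Cmod_ge_0 (Phi x - b)).
      assert (0 <= (1 - Cmod b ^ 2) * (1 - Cmod (Phi x) ^ 2)) by (apply Rmult_le_pos; nra).
      apply Rsqr_incr_0_var; [unfold Rsqr; lra | lra]. }
  rewrite Cmod_div in Q by auto.
  assert (P : 0 < Cmod (1 - Cconj b * Phi z)) by (apply Cmod_gt_0; auto).
  apply Rmult_le_compat_r with (r := Cmod (1 - Cconj b * Phi z)) in Q; [|lra].
  unfold Rdiv in Q; rewrite Rmult_assoc, Rinv_l, Rmult_1_r in Q by lra; auto.
Qed.

(** Positivity is asked for on [0, 1] only: convexity keeps f z + t (w - f z) in the domain for
    these t and not for negative ones. *)
Lemma derivative_ge_0_at_min (D : R -> R) (l : R) : is_derive D 0 l -> D 0 = 0 ->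
  (forall t, 0 <= t <= 1 -> 0 <= D t) -> 0 <= l.
Proof.
  intros HD H0 Hpos; apply Rnot_lt_le; intros Hl.
  apply is_derive_Reals in HD.
  destruct (HD (- l / 2) ltac:(lra)) as [d Hd].
  set (h := Rmin (d / 2) 1).
  assert (Hh : 0 < h) by (apply Rmin_glb_lt; [pose proof (cond_pos d)|]; lra).
  assert (h <= d / 2) by apply Rmin_l; assert (h <= 1) by apply Rmin_r.
  pose proof (cond_pos d).
  specialize (Hd h ltac:(lra) ltac:(rewrite Rabs_pos_eq; lra)).
  rewrite Rplus_0_l, H0, Rminus_0_r in Hd; apply Rabs_def2 in Hd.
  assert (0 <= D h / h) by (apply Rdiv_le_0_compat; auto; apply Hpos; lra).
  lra.
Qed.

(** Q = P - P 0 has Re Q <= 0, and q / (2 eta - q) maps the half-plane Re q < eta into the unit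
    disk, fixing 0. Schwarz's lemma gives |Q z| <= |z| (2 eta + |Q z|), so that Q z = 0 as eta tends
    to 0. *)
Lemma Re_const_of_extremal (P : C -> C) : hol P unit_disk ->
  (forall z, unit_disk z -> Re (P z) <= 0) -> Re (P 0%C) = 0 ->
  forall z, unit_disk z -> Re (P z) = 0.
Proof.
  intros HP Hneg H0 z Hz.
  set (Q := fun x => (P x - P 0)%C).
  assert (HQ : forall x, unit_disk x -> Re (Q x) <= 0).
  { intros x Hx; unfold Q; rewrite Re_minus, H0; specialize (Hneg x Hx); lra. }
  assert (B : forall eta, 0 < eta -> Cmod (Q z) * (1 - Cmod z) <= 2 * eta).
  { intros eta He.
    assert (N : forall x, unit_disk x -> (RtoC (2 * eta) - Q x)%C <> 0%C).
    { intros x Hx E; apply (f_equal Re) in E; rewrite Re_minus, !re_RtoC in E.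
      specialize (HQ x Hx); lra. }
    assert (S := schwarz (fun x => Q x / (RtoC (2 * eta) - Q x))%C).
    simpl in S.
    assert (K : Cmod (Q z / (RtoC (2 * eta) - Q z))%C <= Cmod z).
    { apply S; auto.
      - intros x Hx; destruct (HP x Hx) as [l Hl]; eexists.
        assert (cder Q x (l - 0)%C) by (apply (cder_minus P (fun _ => P 0%C)); auto; apply cder_const).
        apply (cder_div Q (fun x => RtoC (2 * eta) - Q x)%C); eauto.
        apply (cder_minus (fun _ => RtoC (2 * eta)) Q); eauto; apply cder_const.
      - unfold Q; replace (P 0 - P 0)%C with (RtoC 0) by ring; unfold Cdiv; ring.
      - intros x Hx; rewrite Cmod_div by auto.
        assert (Pd : 0 < Cmod (RtoC (2 * eta) - Q x)) by (apply Cmod_gt_0; auto).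
        apply Rmult_le_reg_r with (Cmod (RtoC (2 * eta) - Q x)); auto.
        unfold Rdiv; rewrite Rmult_assoc, Rinv_l, Rmult_1_l, Rmult_1_r by lra.
        assert (I : Cmod (RtoC (2 * eta) - Q x) ^ 2 = Cmod (Q x) ^ 2 + (4 * eta * eta - 4 * eta * Re (Q x))).
        { rewrite !Cmod2_alt; destruct (Q x); unfold RtoC, Cminus, Cplus, Copp, Re, Im; simpl; ring. }
        specialize (HQ x Hx); pose proof (Cmod_ge_0 (Q x)).
        assert (0 <= eta * - Re (Q x)) by (apply Rmult_le_pos; lra).
        apply Rsqr_incr_0_var; [unfold Rsqr; nra | lra]. }
    rewrite Cmod_div in K by auto.
    assert (Pd : 0 < Cmod (RtoC (2 * eta) - Q z)) by (apply Cmod_gt_0; auto).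
    apply Rmult_le_compat_r with (r := Cmod (RtoC (2 * eta) - Q z)) in K; [|lra].
    unfold Rdiv in K; rewrite Rmult_assoc, Rinv_l, Rmult_1_r in K by lra.
    pose proof (Cmod_triangle_minus (RtoC (2 * eta)) (Q z)) as T.
    rewrite Cmod_R, Rabs_pos_eq in T by lra.
    unfold unit_disk in Hz; pose proof (Cmod_ge_0 z); nra. }
  assert (E : Cmod (Q z) * (1 - Cmod z) <= 0).
  { apply (Rle_0_of_small _ 2 1); try lra; intros r Hr; apply B; lra. }
  unfold unit_disk in Hz; pose proof (Cmod_ge_0 (Q z)).
  assert (E0 : Q z = 0%C) by (apply Cmod_eq_0; nra).
  unfold Q in E0; apply Ceq_minus in E0; now rewrite E0.
Qed.

(** * The generator of the contraction towards a point *)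

Definition normalized_convex_map (f : C -> C) (Omega : C -> Prop) : Prop :=
  hol f unit_disk /\ inj_on f unit_disk /\
  (forall w, Omega w <-> exists z, unit_disk z /\ f z = w) /\
  convex_set Omega /\ f 0%C = 0%C /\ C_derive f 0%C = 1%C.

(* The pull-back by [f] of the vector field [v |-> w - v], whose flow contracts
   the image of [f] towards [w]. *)
Definition generator (f : C -> C) (w z : C) : C := ((w - f z) / C_derive f z)%C.

(* The infinitesimal form of the Schwarz-Pick inequality at [0] for the flow of
   [generator f w] is that this function has nonpositive real part. *)
Definition herglotz (f : C -> C) (w z : C) : C :=
  (dquot (generator f w) 0%C z + Cconj w * z)%C.

Definition cclosure (V : C -> Prop) (w : C) : Prop :=
  forall eps, 0 < eps -> exists v, V v /\ Cmod (v - w)%C < eps.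

Lemma unit_disk_0 : unit_disk 0%C.
Proof. unfold unit_disk; rewrite Cmod_0; lra. Qed.

Lemma convex_segment (V : C -> Prop) (u w : C) (t : R) : convex_set V -> V u -> V w ->
  0 <= t <= 1 -> V (u + t * (w - u))%C.
Proof.
  intros HV Hu Hw Ht.
  replace (u + t * (w - u))%C with (RtoC (1 - t) * u + RtoC t * w)%C
    by (rewrite RtoC_minus; ring).
  now apply HV.
Qed.

(** With p = X + i Y and b = U + i V, the images of z and of 0 at time t, and n = |z|^2, the
    function is the squared Schwarz-Pick defect n |1 - conj b p|^2 - |p - b|^2. *)
Lemma is_derive_schwarz_pick (n z1 z2 x' y' u' v' : R) (X Y U V : R -> R) :
  is_derive X 0 x' -> is_derive Y 0 y' -> is_derive U 0 u' -> is_derive V 0 v' ->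
  X 0 = z1 -> Y 0 = z2 -> U 0 = 0 -> V 0 = 0 ->
  is_derive (fun t => n * ((1 - (U t * X t + V t * Y t)) ^ 2 + (U t * Y t - V t * X t) ^ 2)
    - ((X t - U t) ^ 2 + (Y t - V t) ^ 2)) 0
    (- 2 * (z1 * (x' - u') + z2 * (y' - v') + n * (u' * z1 + v' * z2))).
Proof.
  intros HX HY HU HV X0 Y0 U0 V0.
  auto_derive.
  - repeat split; eexists; eauto.
  - change (fun x : R => X x) with X; change (fun x : R => Y x) with Y.
    change (fun x : R => U x) with U; change (fun x : R => V x) with V.
    rewrite (is_derive_unique _ _ _ HX), (is_derive_unique _ _ _ HY),
      (is_derive_unique _ _ _ HU), (is_derive_unique _ _ _ HV), X0, Y0, U0, V0.
    ring.
Qed.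

(* The maps [z |-> f^-1 (f z + t (w - f z))] send the disk into itself; this is
   the derivative at [t = 0] of the Schwarz-Pick inequality for them. *)
Lemma generator_inequality_interior f Omega w z : normalized_convex_map f Omega ->
  Omega w -> unit_disk z ->
  Re (Cconj z * (generator f w z - w))%C + Cmod z ^ 2 * Re (Cconj w * z)%C <= 0.
Proof.
  intros (Hf & Hinj & Him & Hconv & Hf0 & Hf0') Hw Hz.
  pose proof unit_disk_open as HD.
  set (g := inverse_on f unit_disk).
  assert (Hg : forall v, Omega v -> unit_disk (g v) /\ f (g v) = v).
  { intros v Hv; apply inverse_on_spec; now apply Him. }
  assert (Hgf : forall x, unit_disk x -> g (f x) = x) by (intros; now apply inverse_on_left).
  assert (Hfx : forall x, unit_disk x -> Omega (f x)) by (intros; apply Him; eauto).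
  assert (Hder : forall x, unit_disk x -> cder g (f x) (/ C_derive f x)%C)
    by (intros; now apply cder_inverse_on).
  set (path := fun (x : C) (t : R) => g (f x + t * (w - f x))%C).
  assert (Hp : forall x t, unit_disk x -> 0 <= t <= 1 -> unit_disk (path x t)).
  { intros x t Hx Ht; apply Hg, convex_segment; auto. }
  assert (Hp0 : forall x, unit_disk x -> path x 0 = x).
  { intros x Hx; unfold path; replace (f x + 0%R * (w - f x))%C with (f x) by ring; auto. }
  assert (HpD : forall x, unit_disk x ->
    is_derive (fun t => Re (path x t)) 0 (Re (generator f w x)) /\
    is_derive (fun t => Im (path x t)) 0 (Im (generator f w x))).
  { intros x Hx.
    assert (E : (f x + 0%R * (w - f x))%C = f x) by ring.
    replace (generator f w x) with (/ C_derive f x * (w - f x))%C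
      by (unfold generator; unfold Cdiv; ring).
    split; [apply is_derive_Re_path | apply is_derive_Im_path]; rewrite E; auto. }
  assert (SP : forall t, 0 <= t <= 1 ->
    Cmod (path z t - path 0%C t)%C <= Cmod z * Cmod (1 - Cconj (path 0%C t) * path z t)%C).
  { intros t Ht.
    apply (schwarz_pick (fun x => path x t)); auto.
    intros x Hx.
    destruct (Hg (f x + t * (w - f x))%C) as [Q1 Q2]; [now apply convex_segment; auto|].
    exists (/ C_derive f (path x t) * (C_derive f x + (0 * (w - f x) + t * (0 - C_derive f x))))%C.
    apply (cder_comp (fun x => f x + t * (w - f x))%C g).
    - pose proof (hol_C_derive f unit_disk x Hf Hx) as Hdx.
      apply (cder_plus f (fun x => t * (w - f x))%C); auto.
      apply (cder_mult (fun _ => RtoC t) (fun x => w - f x)%C); [apply cder_const|].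
      apply (cder_minus (fun _ => w) f); auto; apply cder_const.
    - rewrite <- Q2 at 1; now apply Hder. }
  (* The image of 0 leaves 0 with velocity [w], by the normalization; this is the origin of the
     terms in [w] of the inequality. *)
  assert (Hgen0 : generator f w 0%C = w).
  { unfold generator; rewrite Hf0, Hf0'; field. }
  destruct (HpD z Hz) as [D1 D2]; destruct (HpD 0%C unit_disk_0) as [D3 D4].
  rewrite Hgen0 in D3, D4.
  pose proof (is_derive_schwarz_pick (Cmod z ^ 2) (Re z) (Im z) _ _ _ _ _ _ _ _ D1 D2 D3 D4) as DD.
  pose proof (Hp0 z Hz) as Ez; pose proof (Hp0 0%C unit_disk_0) as E0.
  specialize (DD (f_equal Re Ez) (f_equal Im Ez) (f_equal Re E0) (f_equal Im E0)).
  apply derivative_ge_0_at_min in DD.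
  - assert (E : Re (Cconj z * (generator f w z - w))%C + Cmod z ^ 2 * Re (Cconj w * z)%C =
      Re z * (Re (generator f w z) - Re w) + Im z * (Im (generator f w z) - Im w)
      + Cmod z ^ 2 * (Re w * Re z + Im w * Im z)).
    { destruct z, w, (generator f (r1, r2) (r, r0)).
      unfold Cconj, Cminus, Cplus, Copp, Cmult, Re, Im; simpl; ring. }
    rewrite E; lra.
  - rewrite !Hp0 by (auto; apply unit_disk_0); simpl (Re 0%C); simpl (Im 0%C).
    rewrite Cmod2_alt; simpl; ring.
  - intros t Ht; specialize (SP t Ht).
    set (p := path z t) in *; set (b := path 0%C t) in *.
    assert (Sq : Cmod (p - b) ^ 2 <= Cmod z ^ 2 * Cmod (1 - Cconj b * p) ^ 2).
    { rewrite <- Rpow_mult_distr; apply pow_incr; split; [apply Cmod_ge_0 | auto]. }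
    rewrite !(Cmod2_alt (_ - _)) in Sq.
    destruct p as [p1 p2], b as [b1 b2]; unfold Cconj, RtoC, Cminus, Cplus, Copp, Cmult, Re, Im in *; simpl in *; nra.
Qed.

(** For fixed [z] the left side is continuous in [w], as [generator f w z] is affine in [w]. The
    closure is needed because an infimum over the domain is only attained there. *)
Lemma generator_inequality f Omega w z : normalized_convex_map f Omega ->
  cclosure Omega w -> unit_disk z ->
  Re (Cconj z * (generator f w z - w))%C + Cmod z ^ 2 * Re (Cconj w * z)%C <= 0.
Proof.
  intros HN Hw Hz.
  set (L := fun v => (Cconj z * (generator f v z - v) + RtoC (Cmod z ^ 2) * (Cconj v * z))%C).
  assert (EL : forall v, Re (L v) = Re (Cconj z * (generator f v z - v))%C + Cmod z ^ 2 * Re (Cconj v * z)%C).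
  { intros v; unfold L; now rewrite re_plus, re_scal_l. }
  rewrite <- EL; apply Rnot_lt_le; intros H.
  assert (CL : ccont L w).
  { unfold L, generator, Cdiv.
    repeat first [apply ccont_minus | apply ccont_plus | apply ccont_opp | apply ccont_mult |
      apply ccont_const | apply ccont_id | apply (ccont_conj (fun v => v))]. }
  destruct (rcont_Re _ _ CL _ H) as [d [Hd HH]].
  destruct (Hw d Hd) as [v [Hv Hvd]].
  specialize (HH v Hvd); apply Rabs_def2 in HH.
  pose proof (generator_inequality_interior f Omega v z HN Hv Hz) as I.
  rewrite <- EL in I; lra.
Qed.

Lemma generator_0 f Omega w : normalized_convex_map f Omega -> generator f w 0%C = w.
Proof.
  intros (Hf & Hinj & Him & Hconv & Hf0 & Hf0'); unfold generator; rewrite Hf0, Hf0'; field.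
Qed.

Lemma cder_generator f Omega w z : normalized_convex_map f Omega -> unit_disk z ->
  cder (generator f w) z (((0 - C_derive f z) * C_derive f z - (w - f z) * C_derive (C_derive f) z)
    / (C_derive f z * C_derive f z))%C.
Proof.
  intros (Hf & Hinj & Him & Hconv & Hf0 & Hf0') Hz; unfold generator.
  apply (cder_div (fun z => w - f z)%C (C_derive f)).
  - apply (cder_minus (fun _ => w) f); [apply cder_const | now apply (hol_C_derive f unit_disk)].
  - apply (hol_C_derive (C_derive f) unit_disk); auto; apply hol_derivative; auto; apply unit_disk_open.
  - apply (injective_derivative_neq_0 f unit_disk); auto; apply unit_disk_open.
Qed.

Lemma hol_herglotz f Omega w : normalized_convex_map f Omega -> hol (herglotz f w) unit_disk.
Proof.
  intros HN z Hz.
  assert (HG : hol (generator f w) unit_disk) by (intros x Hx; eexists; eapply cder_generator; eauto).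
  destruct (hol_dquot (generator f w) unit_disk 0%C unit_disk_open HG unit_disk_0 z Hz) as [l Hl].
  eexists; apply (cder_plus (dquot (generator f w) 0%C) (fun z => Cconj w * z)%C); [exact Hl|].
  apply (cder_mult (fun _ => Cconj w) (fun z => z)); [apply cder_const | apply cder_id].
Qed.

Lemma herglotz_0 f Omega w : normalized_convex_map f Omega ->
  Re (herglotz f w 0%C) = - (1 + 2 * Re (a2 f * w)%C).
Proof.
  intros HN; unfold herglotz; rewrite dquot_self.
  rewrite (cder_C_derive _ _ _ (cder_generator f Omega w 0%C HN unit_disk_0)).
  destruct HN as (Hf & Hinj & Him & Hconv & Hf0 & Hf0'); rewrite Hf0, Hf0'.
  set (q := C_derive (C_derive f) 0).
  assert (E : C_derive (C_derive f) 0 = (2 * a2 f)%C) by (unfold a2; field).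
  unfold q; rewrite E.
  replace (((0 - 1) * 1 - (w - 0) * (2 * a2 f)) / (1 * 1) + Cconj w * 0)%C
    with (- (RtoC 1 + RtoC 2 * (a2 f * w)))%C by field.
  now rewrite re_opp, re_plus, re_scal_l.
Qed.

Lemma Re_herglotz_mult f Omega w z : normalized_convex_map f Omega ->
  Cmod z ^ 2 * Re (herglotz f w z) =
  Re (Cconj z * (generator f w z - w))%C + Cmod z ^ 2 * Re (Cconj w * z)%C.
Proof.
  intros HN; unfold herglotz.
  pose proof (dquot_mult (generator f w) 0%C z) as E.
  rewrite (generator_0 f Omega w HN) in E; rewrite <- E, re_plus.
  set (q := dquot (generator f w) 0%C z).
  replace (Cconj z * (q * (z - 0)))%C with (RtoC (Cmod z ^ 2) * q)%C.
  - rewrite re_scal_l; ring.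
  - rewrite Cmod2_conj; ring.
Qed.

(** Away from 0 the generator inequality is divided by |z|^2. The value at 0, the one that contains
    [a2], is reached by continuity. *)
Lemma herglotz_nonpos f Omega w : normalized_convex_map f Omega -> cclosure Omega w ->
  forall z, unit_disk z -> Re (herglotz f w z) <= 0.
Proof.
  intros HN Hw.
  assert (H : forall z, unit_disk z -> z <> 0%C -> Re (herglotz f w z) <= 0).
  { intros z Hz Nz.
    pose proof (generator_inequality f Omega w z HN Hw Hz) as I.
    rewrite <- (Re_herglotz_mult f Omega) in I by auto.
    apply Cmod_gt_0 in Nz; assert (0 < Cmod z ^ 2) by (apply pow_lt; auto); nra. }
  intros z Hz; apply Rnot_lt_le; intros L.
  assert (Cz : ccont (herglotz f w) z) by (apply (hol_ccont _ unit_disk); auto; eapply hol_herglotz; eauto).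
  destruct (Ceq_dec z 0%C) as [->|Nz]; [|specialize (H z Hz Nz); lra].
  destruct (rcont_Re _ _ Cz _ L) as [d [Hd HH]].
  set (s := Rmin d 1 / 2).
  assert (0 < Rmin d 1) by (apply Rmin_glb_lt; lra).
  pose proof (Rmin_l d 1); pose proof (Rmin_r d 1).
  assert (Ms : Cmod s = s) by (rewrite Cmod_R; apply Rabs_pos_eq; unfold s; lra).
  specialize (HH (RtoC s)).
  replace (s - 0)%C with (RtoC s) in HH by ring.
  rewrite Ms in HH; specialize (HH ltac:(unfold s; lra)); apply Rabs_def2 in HH.
  assert (Re (herglotz f w s) <= 0); [|lra].
  apply H; [unfold unit_disk; rewrite Ms; unfold s; lra|].
  apply Cmod_gt_0; rewrite Ms; unfold s; lra.
Qed.

(** * The extremal case *)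

(** A vanishing real part at 0 forces it to vanish throughout, so the generator inequality becomes
    an equality. The factor 1 - |z|^2 makes the radial component of the generator tend to 0 at the
    unit circle. *)
Lemma Re_generator_extremal f Omega w : normalized_convex_map f Omega -> cclosure Omega w ->
  1 + 2 * Re (a2 f * w)%C = 0 -> forall z, unit_disk z ->
  Re (Cconj z * generator f w z)%C = Re (Cconj z * w)%C * (1 - Cmod z ^ 2).
Proof.
  intros HN Hw H0 z Hz.
  assert (E : Re (herglotz f w z) = 0).
  { apply Re_const_of_extremal; auto.
    - eapply hol_herglotz; eauto.
    - eapply herglotz_nonpos; eauto.
    - rewrite (herglotz_0 f Omega) by auto; lra. }
  pose proof (Re_herglotz_mult f Omega w z HN) as M; rewrite E, Rmult_0_r in M.
  assert (E1 : Re (Cconj z * (generator f w z - w))%C = Re (Cconj z * generator f w z)%C - Re (Cconj z * w)%C).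
  { rewrite <- Re_minus; f_equal; ring. }
  assert (E2 : Re (Cconj w * z)%C = Re (Cconj z * w)%C).
  { destruct z, w; unfold Cconj, Cmult, Re; simpl; ring. }
  rewrite E1, E2 in M; lra.
Qed.

Lemma is_derive_one_minus_squares (X Y : R -> R) (s x' y' : R) :
  is_derive X s x' -> is_derive Y s y' ->
  is_derive (fun t => 1 - (X t ^ 2 + Y t ^ 2)) s (- 2 * (X s * x' + Y s * y')).
Proof.
  intros HX HY; auto_derive; [repeat split; eexists; eauto|].
  change (fun x : R => X x) with X; change (fun x : R => Y x) with Y.
  rewrite (is_derive_unique _ _ _ HX), (is_derive_unique _ _ _ HY); ring.
Qed.

Lemma is_derive_mult_exp (u : R -> R) (k s u' : R) : is_derive u s u' ->
  is_derive (fun t => u t * exp (k * t)) s ((u' + k * u s) * exp (k * s)).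
Proof.
  intros Hu; auto_derive; [repeat split; eexists; eauto|].
  change (fun x : R => u x) with u; rewrite (is_derive_unique _ _ _ Hu); ring.
Qed.

(* Gronwall along the trajectory [s |-> f^-1 (- s w)], which in the extremal
   case reaches the unit circle only as [s] tends to infinity. *)
Lemma extremal_trajectory f Omega w tau : normalized_convex_map f Omega -> cclosure Omega w ->
  1 + 2 * Re (a2 f * w)%C = 0 -> 0 <= tau -> Omega (- tau * w)%C ->
  exists z, unit_disk z /\ f z = (- tau * w)%C /\ exp (- (2 * Cmod w * tau)) <= 1 - Cmod z ^ 2.
Proof.
  intros HN Hw H0 Htau Hin.
  pose proof HN as (Hf & Hinj & Him & Hconv & Hf0 & Hf0').
  set (g := inverse_on f unit_disk).
  assert (Hg : forall v, Omega v -> unit_disk (g v) /\ f (g v) = v).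
  { intros v Hv; apply inverse_on_spec; now apply Him. }
  assert (Om0 : Omega 0%C) by (apply Him; exists 0%C; split; auto; apply unit_disk_0).
  assert (Hseg : forall s, 0 <= s <= tau -> Omega (0 + s * - w)%C).
  { intros s Hs; destruct (Req_dec tau 0) as [T0|T0].
    - replace s with 0 by lra; replace (0 + 0%R * - w)%C with (RtoC 0) by ring; auto.
    - replace (0 + s * - w)%C with (0 + (s / tau)%R * (- tau * w - 0))%C.
      + apply convex_segment; auto; split; [apply Rdiv_le_0_compat; lra|].
        apply Rmult_le_reg_r with tau; [lra|]; unfold Rdiv; rewrite Rmult_assoc, Rinv_l; lra.
      + rewrite RtoC_div by auto; field; intros E; apply T0; now apply RtoC_inj. }
  set (z := fun s : R => g (0 + s * - w)%C).
  set (u := fun s : R => 1 - (Re (z s) ^ 2 + Im (z s) ^ 2)).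
  set (k := 2 * Cmod w).
  assert (Hz0 : z 0 = 0%C).
  { unfold z; replace (0 + 0%R * - w)%C with (f 0%C) by (rewrite Hf0; ring).
    apply inverse_on_left; auto; apply unit_disk_0. }
  assert (Eu : forall s, u s = 1 - Cmod (z s) ^ 2) by (intros; unfold u; now rewrite Cmod2_alt).
  assert (Hu : forall s, 0 <= s <= tau -> exists u', is_derive u s u' /\ - k * u s <= u').
  { intros s Hs; destruct (Hg _ (Hseg s Hs)) as [Dz Fz]; fold (z s) in Dz, Fz.
    assert (Dg : cder g (0 + s * - w)%C (/ C_derive f (z s))%C).
    { rewrite <- Fz; apply cder_inverse_on; auto; apply unit_disk_open. }
    pose proof (is_derive_Re_path g 0 (- w) _ s Dg) as D1.
    pose proof (is_derive_Im_path g 0 (- w) _ s Dg) as D2.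
    set (q := (/ C_derive f (z s) * - w)%C) in *.
    exists (- 2 * (Re (z s) * Re q + Im (z s) * Im q)); split.
    - now apply (is_derive_one_minus_squares (fun s => Re (z s)) (fun s => Im (z s))).
    - assert (Hgen : (generator f w (z s) = - RtoC (1 + s) * q)%C).
      { unfold generator, q; rewrite Fz, RtoC_plus; unfold Cdiv; ring. }
      pose proof (Re_generator_extremal f Omega w HN Hw H0 (z s) Dz) as M.
      rewrite Hgen, <- Eu in M.
      assert (E1 : Re (Cconj (z s) * (- RtoC (1 + s) * q))%C =
        - (1 + s) * (Re (z s) * Re q + Im (z s) * Im q)).
      { destruct (z s), q; unfold Cconj, RtoC, Copp, Cmult, Re, Im; simpl; ring. }
      rewrite E1 in M.
      assert (Pu : 0 <= u s).
      { rewrite Eu; unfold unit_disk in Dz; pose proof (Cmod_ge_0 (z s)); nra. }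
      assert (B : - Cmod w <= Re (Cconj (z s) * w)%C).
      { pose proof (re_le_Cmod (Cconj (z s) * w)%C) as R1; rewrite Cmod_mult, Cmod_conj in R1.
        unfold unit_disk in Dz; pose proof (Cmod_ge_0 w).
        apply Rabs_le_between in R1; nra. }
      set (y := Re (z s) * Re q + Im (z s) * Im q) in *.
      assert (B2 : - Cmod w * u s <= - (1 + s) * y) by (rewrite M; apply Rmult_le_compat_r; auto).
      unfold k.
      assert (P2 : 0 <= Cmod w * u s) by (apply Rmult_le_pos; auto; apply Cmod_ge_0).
      (* From (1 + s) y <= |w| u and 1 + s >= 1 follows y <= |w| u, whatever the sign of y. *)
      apply Rnot_lt_le; intros L.
      assert (Cmod w * u s < y) by lra.
      nra. }
  exists (z tau).
  destruct (Hg _ (Hseg tau ltac:(lra))) as [Dz Fz]; fold (z tau) in Dz, Fz.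
  split; auto; split; [rewrite Fz; ring|].
  rewrite <- Eu.
  (* Integrating factor: u' >= - k u says that this function does not decrease, and it starts at
     1. *)
  set (e := fun s => u s * exp (k * s)).
  assert (He : e 0 <= e tau).
  { destruct (Req_dec tau 0) as [->|T0]; [lra|].
    assert (Hd : forall s, 0 <= s <= tau -> is_derive e s ((Derive u s + k * u s) * exp (k * s))).
    { intros s Hs; destruct (Hu s Hs) as [u' [Du _]].
      rewrite (is_derive_unique _ _ _ Du); now apply is_derive_mult_exp. }
    destruct (MVT_gen e 0 tau (fun s => (Derive u s + k * u s) * exp (k * s))) as [c [Hc E]];
      rewrite ?Rmin_left, ?Rmax_right in * by lra.
    - intros s Hs; apply Hd; lra.
    - intros s Hs; apply derivable_continuous_pt; eexists.
      apply is_derive_Reals, Hd; lra.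
    - destruct (Hu c Hc) as [u' [Du Lu]]; rewrite (is_derive_unique _ _ _ Du) in E.
      pose proof (exp_pos (k * c)).
      assert (0 <= (u' + k * u c) * exp (k * c) * (tau - 0)) by (repeat apply Rmult_le_pos; lra).
      lra. }
  unfold e in He; rewrite Rmult_0_r, exp_0, Rmult_1_r, Eu, Hz0, Cmod_0 in He.
  fold k; rewrite exp_Ropp.
  pose proof (exp_pos (k * tau)).
  apply Rmult_le_reg_r with (exp (k * tau)); auto.
  rewrite Rinv_l by lra; lra.
Qed.

(** * Exclusion of the extremal case and the uniform bound *)

Lemma cluster_in_closure (V : C -> Prop) (u : nat -> C) (w : C) : (forall n, V (u n)) ->
  (forall eps N, 0 < eps -> exists n, (N <= n)%nat /\ Cmod (u n - w)%C < eps) -> cclosure V w.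
Proof. intros HV Hw e He; destruct (Hw e O He) as [n [_ Hn]]; eauto. Qed.

(** Let T be the supremum of the tau with - tau w in the image, finite by boundedness. The preimages
    stay in |z|^2 <= 1 - exp (- 2 |w| T), so they cluster inside the disk at a preimage of - T w;
    openness of [f] there carries the ray beyond T. *)
Lemma convex_map_not_extremal f Omega w : normalized_convex_map f Omega -> bounded_set Omega ->
  cclosure Omega w -> 1 + 2 * Re (a2 f * w)%C <> 0.
Proof.
  intros HN [M HM] Hw H0.
  pose proof HN as (Hf & Hinj & Him & Hconv & Hf0 & Hf0').
  assert (Nw : 0 < Cmod w).
  { apply Cmod_gt_0; intros ->; rewrite Cmult_0_r, re_RtoC in H0; lra. }
  set (E := fun tau => 0 <= tau /\ Omega (- tau * w)%C).
  destruct (completeness E) as [T [HT1 HT2]].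
  { exists (M / Cmod w); intros t [Ht Hin]; specialize (HM _ Hin).
    rewrite Cmod_mult, Cmod_opp, Cmod_R, Rabs_pos_eq in HM by auto.
    apply Rmult_le_reg_r with (Cmod w); auto.
    unfold Rdiv; rewrite Rmult_assoc, Rinv_l; lra. }
  { exists 0; split; [lra|]; apply Him; exists 0%C; split; [apply unit_disk_0|].
    rewrite Hf0; ring. }
  assert (Hsup : forall n : nat, exists z, unit_disk z /\
    Cmod (f z - (- T * w))%C <= Cmod w * / (INR n + 1) /\ exp (- (2 * Cmod w * T)) <= 1 - Cmod z ^ 2).
  { intros n; set (d := / (INR n + 1)).
    assert (Hd : 0 < d) by (apply Rinv_0_lt_compat; pose proof (pos_INR n); lra).
    assert (exists tau, E tau /\ T - d < tau) as [tau [[Ht Hin] Htd]].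
    { apply NNPP; intros N; assert (T <= T - d); [|lra].
      apply HT2; intros t Et; apply Rnot_lt_le; intros L; apply N; eauto. }
    assert (HtT : tau <= T) by (apply HT1; split; auto).
    destruct (extremal_trajectory f Omega w tau HN Hw H0 Ht Hin) as (z & Dz & Fz & Bz).
    exists z; repeat split; auto.
    - rewrite Fz; replace (- tau * w - - T * w)%C with (RtoC (T - tau) * w)%C by (rewrite RtoC_minus; ring).
      rewrite Cmod_mult, Cmod_R, Rabs_pos_eq by lra; nra.
    - eapply Rle_trans; [|exact Bz].
      assert (2 * Cmod w * tau <= 2 * Cmod w * T) by (apply Rmult_le_compat_l; lra).
      destruct (Rle_lt_or_eq_dec (2 * Cmod w * tau) (2 * Cmod w * T)) as [L|E2]; auto.
      + left; apply exp_increasing; lra.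
      + rewrite E2; lra. }
  set (zn := fun n => proj1_sig (constructive_indefinite_description _ (Hsup n))).
  assert (Hzn : forall n, unit_disk (zn n) /\
    Cmod (f (zn n) - (- T * w))%C <= Cmod w * / (INR n + 1) /\ exp (- (2 * Cmod w * T)) <= 1 - Cmod (zn n) ^ 2).
  { intros n; unfold zn; now destruct (constructive_indefinite_description _ (Hsup n)). }
  set (eta := exp (- (2 * Cmod w * T))) in *.
  assert (Heta : 0 < eta) by apply exp_pos.
  destruct (bounded_cluster_point zn 1) as [z Hz].
  { intros n; destruct (Hzn n) as [H _]; unfold unit_disk in H; lra. }
  assert (Dz : unit_disk z).
  { unfold unit_disk; apply Rnot_le_lt; intros L.
    (* If |z| >= 1, some [zn n] has modulus above 1 - eta / 4, hence 1 - |zn n|^2 < eta / 2, against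
       the lower bound eta. *)
    destruct (Hz (eta / 4) O ltac:(lra)) as [n [_ Hn]].
    destruct (Hzn n) as (D & _ & B); unfold unit_disk in D.
    pose proof (Cmod_triangle_rev z (z - zn n)) as R1.
    replace (z - (z - zn n))%C with (zn n) in R1 by ring.
    rewrite Cmod_minus_sym in Hn; pose proof (Cmod_ge_0 (zn n)); nra. }
  assert (Fz : f z = (- T * w)%C).
  { apply Ceq_minus, Cmod_eq_0, Rle_antisym; [|apply Cmod_ge_0].
    apply Rnot_lt_le; intros L.
    set (x := Cmod (f z - - T * w)) in *.
    destruct (hol_ccont f unit_disk z Hf Dz (x / 2) ltac:(lra)) as [d [Hd HH]].
    destruct (Rinv_INR_small (x / 2 / Cmod w)) as [N HNN].
    { repeat apply Rdiv_lt_0_compat; lra. }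
    destruct (Hz d N Hd) as [n [Hn1 Hn2]].
    specialize (HH _ Hn2); specialize (HNN n Hn1).
    destruct (Hzn n) as (_ & B & _).
    apply Rmult_lt_compat_l with (r := Cmod w) in HNN; auto.
    replace (Cmod w * (x / 2 / Cmod w)) with (x / 2) in HNN by (field; lra).
    pose proof (Cmod_triangle_via (f z) (f (zn n)) (- T * w)) as R1; fold x in R1.
    rewrite (Cmod_minus_sym (f z)) in R1; lra. }
  destruct (injective_open_mapping f unit_disk z 1 unit_disk_open Hf Hinj Dz ltac:(lra)) as [d [Hd HH]].
  set (s := d / 2 / Cmod w).
  assert (Hs : 0 < s) by (repeat apply Rdiv_lt_0_compat; lra).
  assert (T + s <= T); [|lra].
  assert (HT0 : 0 <= T).
  { apply HT1; split; [lra|]; apply Him; exists 0%C; split; [apply unit_disk_0|].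
    rewrite Hf0; ring. }
  apply HT1; split; [lra|].
  destruct (HH (- RtoC (T + s) * w)%C) as (z' & Dz' & _ & Fz').
  - rewrite Fz; replace (- RtoC (T + s) * w - - T * w)%C with (- (RtoC s * w))%C by (rewrite RtoC_plus; ring).
    rewrite Cmod_opp, Cmod_mult, Cmod_R, Rabs_pos_eq by lra; unfold s.
    replace (d / 2 / Cmod w * Cmod w) with (d / 2) by (field; lra); lra.
  - apply Him; eauto.
Qed.

(** A sequence violating every delta clusters at some w of the closure. There 1 + 2 Re (a2 w) is
    nonnegative by [herglotz_nonpos] at 0 and nonpositive by continuity, so it vanishes, which is
    excluded. *)
Lemma convex_map_half_plane f Omega : normalized_convex_map f Omega -> bounded_set Omega ->
  exists delta, 0 < delta /\ forall w, Omega w -> delta <= 1 + 2 * Re (a2 f * w)%C.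
Proof.
  intros HN HB.
  apply NNPP; intros N.
  assert (H : forall n : nat, exists w, Omega w /\ 1 + 2 * Re (a2 f * w)%C < / (INR n + 1)).
  { intros n; apply NNPP; intros N'; apply N.
    exists (/ (INR n + 1)); split; [apply Rinv_0_lt_compat; pose proof (pos_INR n); lra|].
    intros w Hw; apply Rnot_lt_le; intros L; apply N'; eauto. }
  set (wn := fun n => proj1_sig (constructive_indefinite_description _ (H n))).
  assert (Hwn : forall n, Omega (wn n) /\ 1 + 2 * Re (a2 f * wn n)%C < / (INR n + 1)).
  { intros n; unfold wn; now destruct (constructive_indefinite_description _ (H n)). }
  pose proof HB as [M HM].
  destruct (bounded_cluster_point wn M) as [w Hw]; [intros n; apply HM, Hwn|].
  assert (Cw : cclosure Omega w) by (apply (cluster_in_closure Omega wn); auto; intros n; apply Hwn).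
  apply (convex_map_not_extremal f Omega w HN HB Cw).
  pose proof (herglotz_nonpos f Omega w HN Cw 0%C unit_disk_0) as L1.
  rewrite (herglotz_0 f Omega) in L1 by auto.
  apply Rle_antisym; [|lra].
  apply Rnot_lt_le; intros L.
  set (x := 1 + 2 * Re (a2 f * w)%C) in *.
  assert (Cc : ccont (fun w => a2 f * w)%C w) by (apply ccont_mult; [apply ccont_const | apply ccont_id]).
  destruct (rcont_Re _ _ Cc (x / 4) ltac:(lra)) as [d [Hd HH]].
  destruct (Rinv_INR_small (x / 2) ltac:(lra)) as [n0 Hn0].
  destruct (Hw d n0 Hd) as [n [Hn1 Hn2]].
  specialize (HH _ Hn2); specialize (Hn0 n Hn1); apply Rabs_def2 in HH.
  destruct (Hwn n) as [_ B]; unfold x in *; lra.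
Qed.

(** |zeta / (1 + zeta)|^2 = |zeta|^2 / (|zeta|^2 + 1 + 2 Re zeta) is at most |zeta|^2 / (|zeta|^2 +
    delta), which increases with |zeta|. *)
Lemma Cmod_div_one_plus_bound (zeta : C) (N delta : R) : 0 < delta -> Cmod zeta <= N ->
  delta <= 1 + 2 * Re zeta ->
  (1 + zeta)%C <> 0%C /\ Cmod (zeta / (1 + zeta))%C <= sqrt (N ^ 2 / (N ^ 2 + delta)).
Proof.
  intros Hd HN Hz.
  assert (I : Cmod (1 + zeta) ^ 2 = 1 + 2 * Re zeta + Cmod zeta ^ 2).
  { rewrite !Cmod2_alt; destruct zeta; unfold RtoC, Cplus, Re, Im; simpl; ring. }
  pose proof (Cmod_ge_0 zeta) as P.
  assert (Nz : (1 + zeta)%C <> 0%C).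
  { intros E; rewrite E, Cmod_0 in I; nra. }
  split; auto.
  rewrite Cmod_div by auto.
  assert (P1 : 0 < Cmod (1 + zeta)) by now apply Cmod_gt_0.
  rewrite <- (sqrt_pow2 (Cmod zeta / Cmod (1 + zeta))) by (apply Rdiv_le_0_compat; auto).
  apply sqrt_le_1_alt.
  replace ((Cmod zeta / Cmod (1 + zeta)) ^ 2) with (Cmod zeta ^ 2 / Cmod (1 + zeta) ^ 2) by (field; lra).
  assert (H2 : Cmod zeta ^ 2 <= N ^ 2) by (apply pow_incr; auto).
  assert (P2 : 0 < Cmod (1 + zeta) ^ 2) by (apply pow_lt; auto).
  assert (P3 : 0 < N ^ 2 + delta) by (pose proof (pow2_ge_0 N); lra).
  apply Rmult_le_reg_r with (Cmod (1 + zeta) ^ 2 * (N ^ 2 + delta)); [now apply Rmult_lt_0_compat|].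
  replace (Cmod zeta ^ 2 / Cmod (1 + zeta) ^ 2 * (Cmod (1 + zeta) ^ 2 * (N ^ 2 + delta)))
    with (Cmod zeta ^ 2 * (N ^ 2 + delta)) by (field; lra).
  replace (N ^ 2 / (N ^ 2 + delta) * (Cmod (1 + zeta) ^ 2 * (N ^ 2 + delta)))
    with (N ^ 2 * Cmod (1 + zeta) ^ 2) by (field; lra).
  rewrite I; pose proof (pow2_ge_0 N); pose proof (pow2_ge_0 (Cmod zeta)); nra.
Qed.

Open Scope C_scope.

(* [Cdiv] is total, so the conclusion also records that the denominator of
   [fstar f] does not vanish on the disk. *)
Theorem theorem2p4 :
  forall (f : C -> C) (Omega : C -> Prop),
    bounded_convex_domain Omega ->
    conformal_map_onto f unit_disk Omega ->
    f 0 = 0 ->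
    C_derive f 0 = 1 ->
    exists c : R, (c < 1)%R /\
      forall z : C, unit_disk z ->
        1 + a2 f * f z <> 0 /\ (Cmod (a2 f * fstar f z) <= c)%R.
Proof.
  intros f Omega (_ & _ & Hconv & HB) (Hf & Hinj & Him) Hf0 Hf0'.
  assert (HN : normalized_convex_map f Omega).
  { repeat split; auto; try apply Him; now apply holomorphic_on_hol. }
  destruct (convex_map_half_plane f Omega HN HB) as [delta [Hd Hdelta]].
  destruct HB as [M HM].
  (* Bound for |a2 f| on the disk; it keeps the constant below 1 uniformly in z. *)
  set (N := (Cmod (a2 f) * M)%R).
  exists (sqrt (N ^ 2 / (N ^ 2 + delta)))%R; split.
  - pose proof (pow2_ge_0 N).
    rewrite <- sqrt_1; apply sqrt_lt_1_alt; split; [apply Rdiv_le_0_compat; lra|].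
    apply Rmult_lt_reg_r with (N ^ 2 + delta)%R; [lra|].
    unfold Rdiv; rewrite Rmult_assoc, Rinv_l; lra.
  - intros z Hz.
    assert (Hw : Omega (f z)) by (apply Him; eauto).
    destruct (Cmod_div_one_plus_bound (a2 f * f z) N delta Hd) as [H1 H2].
    + rewrite Cmod_mult; apply Rmult_le_compat_l; [apply Cmod_ge_0 | auto].
    + auto.
    + split; auto.
      replace (a2 f * fstar f z) with (a2 f * f z / (1 + a2 f * f z)); auto.
      unfold fstar; field; auto.
Qed.
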